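(* Let $B>0$. Consider the directed exponential network model with interaction effect on nodes $\{1,\dots,n\}$: for each pair $i<j\le n$ the pair $Y_{ij}=(a_{ij},a_{ji})\in\{0,1\}^2$ is drawn, independently over pairs, from $$ g(a_{ij},a_{ji};\alpha_i,\beta_i,\alpha_j,\beta_j,\rho)=\frac{\exp\{(\alpha_i+\beta_j)a_{ij}+(\beta_i+\alpha_j)a_{ji}+\rho\, a_{ij}a_{ji}\}}{Z(\alpha_i,\beta_i,\alpha_j,\beta_j,\rho)}, $$ with $Z$ the normalizing constant, at true parameters $\alpha^*_i,\beta^*_i,\rho^*$, all in $[-B,B]$, with $\alpha^*_1=0$. Let $(\hat{\boldsymbol\alpha},\hat{\boldsymbol\beta},\hat\rho)$ be the maximum likelihood estimator normalized by $\hat\alpha_1=0$. Then $$ \|\hat{\boldsymbol\alpha}-\boldsymbol\alpha^*\|_\infty+\|\hat{\boldsymbol\beta}-\boldsymbol\beta^*\|_\infty=O_p\big(n^{-1/8}\sqrt{\log n}\big). $$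
   Context: $a_{ij}=1$ indicates a directed edge from $i$ to $j$. The parameters $(\boldsymbol\alpha,\boldsymbol\beta,\rho)$ and $(\boldsymbol\alpha-x,\boldsymbol\beta+x,\rho)$ define the same model, so the normalization $\alpha_1=0$ is imposed. The MLE maximizes $\sum_{i<j}\log g(a_{ij},a_{ji};\alpha_i,\beta_i,\alpha_j,\beta_j,\rho)$ over the parameter space with all coordinates in $[-B,B]$ and $\alpha_1=0$. *)

(* Defs.v *)
From mathcomp Require Import all_boot all_order all_algebra.
From mathcomp Require Import all_classical all_reals all_analysis.
Set Implicit Arguments. Unset Strict Implicit. Unset Printing Implicit Defensive.
Import Order.TTheory GRing.Theory Num.Theory.
Local Open Scope ring_scope.

Section Model.
Variable R : realType.

Definition gnum (x y : bool) (ai bi aj bj rho : R) : R :=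
  expR ((ai + bj) * (x : nat)%:R + (bi + aj) * (y : nat)%:R
        + rho * (x : nat)%:R * (y : nat)%:R).

Definition gZ (ai bi aj bj rho : R) : R :=
  \sum_(x : bool) \sum_(y : bool) gnum x y ai bi aj bj rho.

Definition g (x y : bool) (ai bi aj bj rho : R) : R :=
  gnum x y ai bi aj bj rho / gZ ai bi aj bj rho.

(* a directed graph on nodes 'I_n : a (i,j) = a_ij (diagonal ignored / forced false) *)
Definition graph (n : nat) := {ffun 'I_n * 'I_n -> bool}.

Definition mass (n : nat) (alpha beta : 'I_n -> R) (rho : R) (a : graph n) : R :=
  (\prod_(i : 'I_n) \prod_(j : 'I_n | (i < j)%N)
      g (a (i, j)) (a (j, i)) (alpha i) (beta i) (alpha j) (beta j) rho)
  * ([forall i : 'I_n, ~~ a (i, i)] : nat)%:R.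

Definition Prob (n : nat) (alpha beta : 'I_n -> R) (rho : R) (E : pred (graph n)) : R :=
  \sum_(a : graph n | E a) mass alpha beta rho a.

Definition loglik (n : nat) (a : graph n) (alpha beta : 'I_n -> R) (rho : R) : R :=
  \sum_(i : 'I_n) \sum_(j : 'I_n | (i < j)%N)
      ln (g (a (i, j)) (a (j, i)) (alpha i) (beta i) (alpha j) (beta j) rho).

(* parameter space: all coordinates in [-B,B], alpha_1 = 0 (node 1 = index 0) *)
Definition admissible (B : R) (n : nat) (alpha beta : 'I_n -> R) (rho : R) : Prop :=
  (forall i, - B <= alpha i <= B) /\ (forall i, - B <= beta i <= B) /\
  - B <= rho <= B /\ (forall i : 'I_n, val i = 0%N -> alpha i = 0).

Definition isMLE (B : R) (n : nat) (a : graph n) (alpha beta : 'I_n -> R) (rho : R) : Prop :=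
  admissible B alpha beta rho /\
  forall alpha' beta' rho', admissible B alpha' beta' rho' ->
    loglik a alpha' beta' rho' <= loglik a alpha beta rho.

Definition supnorm (n : nat) (x : 'I_n -> R) : R := \big[Num.max/0]_(i : 'I_n) `|x i|.

Definition rate (n : nat) : R := (n%:R `^ (- (8%:R)^-1)) * Num.sqrt (ln n%:R).

End Model.

(* Main.v *)
(* Write [a_i], [b_i] for the errors of the estimator.  The likelihood being concave, the
   estimator satisfies a variational inequality over the (convex) parameter space: the score
   at the estimator does not increase along any admissible direction.  In the direction of the
   true parameter, strong monotonicity of the mean map of a dyad and the bound [n^(3/4)] on
   all centred degrees give [sum_(i, j) (a_i + b_j)^2 = O(n^(7/4))], so that [a_i] and [- b_i]
   are, on average over [i], within [O(n^(-1/8))] of a common shift [x].  In the directions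
   of the single coordinates, the score of node [i] is then, up to [O(n^(7/8))], a function
   of [a_i - x] and [b_i + x] only, in which the larger of the two deviations decides
   the sign.  If [x] were large, this would force all scores in [alpha] to have the
   sign of [x] and all scores in [beta] the opposite one, strictly so at the first node, whose
   error [a_1] is [0]; but the scores in [alpha] and those in [beta] have the same sum.  Hence
   [x], and then every deviation, is [O(n^(-1/8))]. *)
Require Import Defs.
From mathcomp Require Import all_boot all_order all_algebra.
From mathcomp Require Import all_classical all_reals all_analysis.
From mathcomp Require Import ring lra.
Import Order.TTheory GRing.Theory Num.Theory.
Local Open Scope ring_scope.

(** * The model of a single dyad *)

(** The law of a dyad depends on its nodes only through [u], [v], [w]: an exponential family with
    log-normalizer [ln (dyadZ u v w)]. *)
Definition dyadZ {R : realType} (u v w : R) : R :=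
  1 + expR u + expR v + expR (u + v + w).

(* The probability that [a_ij = 1], for [u = alpha_i + beta_j], [v = beta_i + alpha_j] and
   [w = rho]; the one that [a_ji = 1] is [edgep v u w]. *)
Definition edgep {R : realType} (u v w : R) : R :=
  (expR u + expR (u + v + w)) / dyadZ u v w.

(** The probability that both edges are present. [edgep u v w], [edgep v u w] and [recp u v w] are
    the partial derivatives of [ln (dyadZ u v w)]. *)
Definition recp {R : realType} (u v w : R) : R := expR (u + v + w) / dyadZ u v w.

Lemma dyadZ_gt0 (R : realType) (u v w : R) : 0 < dyadZ u v w.
Proof.
rewrite /dyadZ; have := expR_gt0 u; have := expR_gt0 v.
have := expR_gt0 (u + v + w); lra.
Qed.

Lemma gZE (R : realType) (ai bi aj bj rho : R) :
  gZ ai bi aj bj rho = dyadZ (ai + bj) (bi + aj) rho.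
Proof.
rewrite /gZ /gnum /dyadZ !big_bool /=.
rewrite !(mulr1, mulr0, addr0, add0r) expR0; lra.
Qed.

Lemma lng (R : realType) (x y : bool) (ai bi aj bj rho : R) :
  ln (g x y ai bi aj bj rho) =
  (ai + bj) * (x : nat)%:R + (bi + aj) * (y : nat)%:R + rho * (x : nat)%:R * (y : nat)%:R
  - ln (dyadZ (ai + bj) (bi + aj) rho).
Proof.
rewrite /g gZE ln_div ?posrE ?expR_gt0 ?dyadZ_gt0 //.
by rewrite /gnum expRK.
Qed.

Lemma g_ge0 (R : realType) (x y : bool) (ai bi aj bj rho : R) :
  0 <= g x y ai bi aj bj rho.
Proof. by rewrite /g gZE divr_ge0 ?ltW ?expR_gt0 ?dyadZ_gt0. Qed.

Lemma g_swap (R : realType) (x y : bool) (ai bi aj bj rho : R) :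
  g x y ai bi aj bj rho = g y x aj bj ai bi rho.
Proof.
rewrite /g !gZE /gnum /dyadZ; congr (expR _ / _); first by ring.
rewrite (addrC bj ai) (addrC aj bi) (addrC (bi + aj)).
by ring.
Qed.

Lemma sum_g (R : realType) (ai bi aj bj rho : R) :
  \sum_(x : bool) \sum_(y : bool) g x y ai bi aj bj rho = 1.
Proof.
have Z0 := dyadZ_gt0 R (ai + bj) (bi + aj) rho.
rewrite /g; under eq_bigr do rewrite -mulr_suml.
by rewrite -mulr_suml -/(gZ ai bi aj bj rho) gZE divff // gt_eqF.
Qed.

Lemma mean_edge (R : realType) (ai bi aj bj rho : R) :
  \sum_(x : bool) \sum_(y : bool) g x y ai bi aj bj rho * (x : nat)%:R
  = edgep (ai + bj) (bi + aj) rho.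
Proof.
rewrite !big_bool /= /g gZE /edgep /gnum /=.
rewrite !(mulr1, mulr0, addr0, add0r) addrC -mulrDl; congr (_ / _).
Qed.

Lemma mean_rec (R : realType) (ai bi aj bj rho : R) :
  \sum_(x : bool) \sum_(y : bool)
     g x y ai bi aj bj rho * ((x : nat)%:R * (y : nat)%:R)
  = recp (ai + bj) (bi + aj) rho.
Proof.
rewrite !big_bool /= /g gZE /recp /gnum /=.
by rewrite !(mulr1, mulr0, addr0, add0r).
Qed.

Lemma edgep_bounds (R : realType) (u v w : R) : 0 <= edgep u v w <= 1.
Proof.
have Z0 := dyadZ_gt0 R u v w.
rewrite /edgep ler_pdivrMr // mul1r divr_ge0 ?ltW ?addr_gt0 ?expR_gt0 //=.
rewrite /dyadZ; have := expR_gt0 v; lra.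
Qed.

Lemma recp_bounds (R : realType) (u v w : R) : 0 <= recp u v w <= 1.
Proof.
have Z0 := dyadZ_gt0 R u v w.
rewrite /recp ler_pdivrMr // mul1r divr_ge0 ?ltW ?expR_gt0 //=.
rewrite /dyadZ; have := expR_gt0 v; have := expR_gt0 u; lra.
Qed.

Lemma dyadZC (R : realType) (u v w : R) : dyadZ v u w = dyadZ u v w.
Proof. by rewrite /dyadZ (addrC v u); ring. Qed.

Lemma recpC (R : realType) (u v w : R) : recp v u w = recp u v w.
Proof. by rewrite /recp dyadZC (addrC v u). Qed.

(** From [expR (- t) >= 1 - t] follows [expR t <= 1 / (1 - t) = 1 + t + t ^+ 2 / (1 - t)]. *)
Lemma expR_le_quadratic (R : realType) (t : R) :
  `|t| <= 2^-1 -> expR t <= 1 + t + 2 * t ^+ 2.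
Proof.
rewrite ler_norml => /andP[t1 t2].
have h := expR_ge1Dx (- t).
have e0 := expR_gt0 t.
have : expR t * expR (- t) = 1 by rewrite -expRD subrr expR0.
nra.
Qed.

(** An explicit quadratic remainder lets first-order conditions be derived without differentiating
    the likelihood. It comes from [ln (Z' / Z) <= Z' / Z - 1] and the quadratic bound on each
    exponential. *)
Lemma lng_ge_linear (R : realType) (x y : bool) (ai bi aj bj rho ai' bi' aj' bj' rho' : R) :
  let h1 := (ai' - ai) + (bj' - bj) in
  let h2 := (bi' - bi) + (aj' - aj) in
  let h3 := rho' - rho in
  `|h1| + `|h2| + `|h3| <= 2^-1 ->
  ((x : nat)%:R - edgep (ai + bj) (bi + aj) rho) * h1
  + ((y : nat)%:R - edgep (bi + aj) (ai + bj) rho) * h2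
  + ((x : nat)%:R * (y : nat)%:R - recp (ai + bj) (bi + aj) rho) * h3
  - 2 * (`|h1| + `|h2| + `|h3|) ^+ 2
  <= ln (g x y ai' bi' aj' bj' rho') - ln (g x y ai bi aj bj rho).
Proof.
move=> h1 h2 h3 hs; rewrite !lng.
set u := ai + bj; set v := bi + aj.
have -> : ai' + bj' = u + h1 by rewrite /u /h1; ring.
have -> : bi' + aj' = v + h2 by rewrite /v /h2; ring.
have -> : rho' = rho + h3 by rewrite /h3; ring.
clearbody u v h1 h2 h3; set s := `|h1| + _ + _ in hs *.
have Z0 := dyadZ_gt0 R u v rho.
have Z1 := dyadZ_gt0 R (u + h1) (v + h2) (rho + h3).
have n1 := normr_ge0 h1; have n2 := normr_ge0 h2; have n3 := normr_ge0 h3.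
have step (h : R) : `|h| <= s -> expR h <= 1 + h + 2 * s ^+ 2.
  move=> hh; apply: le_trans (expR_le_quadratic _ _ _) _.
    exact: le_trans hh hs.
  by move: hh; rewrite ler_norml => /andP[hh1 hh2]; nra.
have e1 : expR h1 <= 1 + h1 + 2 * s ^+ 2 by apply: step; rewrite /s; lra.
have e2 : expR h2 <= 1 + h2 + 2 * s ^+ 2 by apply: step; rewrite /s; lra.
have e3 : expR (h1 + h2 + h3) <= 1 + (h1 + h2 + h3) + 2 * s ^+ 2.
  apply: step; rewrite /s; apply: le_trans (ler_normD _ _) _.
  by rewrite lerD2r ler_normD.
have key : ln (dyadZ (u + h1) (v + h2) (rho + h3)) - ln (dyadZ u v rho) <=
   edgep u v rho * h1 + edgep v u rho * h2 + recp u v rho * h3 + 2 * s ^+ 2.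
  rewrite -ln_div ?posrE //.
  set Z' := dyadZ (u + _) _ _ in Z1 *; set Z := dyadZ u v rho in Z0 *.
  have -> : Z' / Z = 1 + (Z' / Z - 1) by ring.
  apply: le_trans (le_ln1Dx _) _; first by rewrite ltrBrDr addNr divr_gt0.
  rewrite -(ler_pM2r Z0) mulrBl divfK ?gt_eqF // mul1r.
  have -> : (edgep u v rho * h1 + edgep v u rho * h2 + recp u v rho * h3 + 2 * s ^+ 2) * Z =
    (expR u + expR (u + v + rho)) * h1 + (expR v + expR (u + v + rho)) * h2
     + expR (u + v + rho) * h3 + 2 * s ^+ 2 * Z.
    rewrite /edgep /recp (dyadZC _ u v) (addrC v u) -/Z; field; exact: lt0r_neq0.
  rewrite /Z' /Z /dyadZ.
  have -> : u + h1 + (v + h2) + (rho + h3) = (u + v + rho) + (h1 + h2 + h3) by ring.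
  rewrite !expRD -(expRD u v) -(expRD (u + v) rho) -!expRD (expRD u) (expRD v) (expRD (u + v + rho)).
  have := ler_wpM2l (expR_ge0 u) e1; have := ler_wpM2l (expR_ge0 v) e2.
  have := ler_wpM2l (expR_ge0 (u + v + rho)) e3.
  have := sqr_ge0 s; lra.
lra.
Qed.

(** A total perturbation [s] changes numerator and denominator each by a factor of at least
    [expR (- s)] and at most [expR s]. As [edgep] is at most 1, it drops by at most
    [1 - expR (- s - s) <= 2 * s]. *)
Lemma edgep_lipschitz (R : realType) (u v w u' v' w' : R) :
  `|edgep u v w - edgep u' v' w'| <= 2 * (`|u - u'| + `|v - v'| + `|w - w'|).
Proof.
suff H (a b c a' b' c' s : R) : `|a - a'| + `|b - b'| + `|c - c'| <= s ->
    edgep a b c - edgep a' b' c' <= 2 * s.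
  set s := _ + _ + _; rewrite ler_norml; apply/andP; split; last exact: H.
  have : edgep u' v' w' - edgep u v w <= 2 * s.
    by apply: H; rewrite /s (distrC u') (distrC v') (distrC w').
  lra.
move=> hs.
have n1 := normr_ge0 (a - a'); have n2 := normr_ge0 (b - b'); have n3 := normr_ge0 (c - c').
have /andP[a1 a2] : - `|a - a'| <= a - a' <= `|a - a'| by rewrite -ler_norml.
have /andP[b1 b2] : - `|b - b'| <= b - b' <= `|b - b'| by rewrite -ler_norml.
have /andP[c1 c2] : - `|c - c'| <= c - c' <= `|c - c'| by rewrite -ler_norml.
have s0 : 0 <= s by lra.
have num : expR (- s) * (expR a + expR (a + b + c)) <= expR a' + expR (a' + b' + c').
  by rewrite mulrDr -!expRD lerD // ler_expR; lra.
have den : expR (- s) * dyadZ a' b' c' <= dyadZ a b c.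
  rewrite /dyadZ !mulrDr mulr1 -!expRD !lerD // ?ler_expR; try lra.
  by rewrite -[leRHS]expR0 ler_expR; lra.
have Z0 := dyadZ_gt0 R a b c; have Z1 := dyadZ_gt0 R a' b' c'.
have e0 := expR_gt0 (- s).
have : expR (- s) * expR (- s) * edgep a b c <= edgep a' b' c'.
  rewrite /edgep ler_pdivlMr //.
  have -> : expR (- s) * expR (- s) * ((expR a + expR (a + b + c)) / dyadZ a b c) * dyadZ a' b' c'
    = expR (- s) * (expR a + expR (a + b + c)) * (expR (- s) * dyadZ a' b' c' / dyadZ a b c) by ring.
  apply: le_trans num; rewrite ler_piMr ?mulr_ge0 ?addr_ge0 ?expR_ge0 //.
  by rewrite ler_pdivrMr // mul1r.
rewrite -expRD.
have := expR_ge1Dx (- s - s); have := edgep_bounds R a b c.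
move=> /andP[]; nra.
Qed.

(** For [A >= 0], the condition [|D| <= A] makes [expR A] at least [expR D] and [expR (- D)]; this
    is what keeps the difference, cleared of denominators, a sum of nonnegative terms, whatever the
    sign of [w]. *)
Lemma edgep_dominance (R : realType) (H : R) : exists2 c : R, 0 < c &
  forall u v w A D : R, `|u| <= H -> `|v| <= H -> `|w| <= H ->
    `|u + A| <= H -> `|v + D| <= H -> `|D| <= `|A| ->
    c * A ^+ 2 <= A * (edgep (u + A) (v + D) w - edgep u v w).
Proof.
(* A lower bound of [expR u] over an upper bound of the product of the two normalizers. *)
exists (expR (- H) / (4 * expR (3 * H)) ^+ 2) => [|u v w A D hu hv hw huA hvD DA].
  by rewrite divr_gt0 ?exprn_gt0 ?mulr_gt0 ?expR_gt0.
set c := _ / _.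
have H0 : 0 <= H by exact: le_trans hu.
have Zle (a b : R) : `|a| <= H -> `|b| <= H -> dyadZ a b w <= 4 * expR (3 * H).
  rewrite !ler_norml => /andP[_ ha] /andP[_ hb]; move: hw; rewrite ler_norml => /andP[_ hw].
  have -> : 4 * expR (3 * H) = expR (3 * H) + expR (3 * H) + expR (3 * H) + expR (3 * H) by ring.
  rewrite /dyadZ !lerD ?ler_expR //; try lra.
  by rewrite -[leLHS]expR0 ler_expR; lra.
have pos (a b x y : R) : `|a| <= H -> `|b| <= H -> `|a + x| <= H -> `|b + y| <= H ->
    0 <= x -> `|y| <= x -> c * x <= edgep (a + x) (b + y) w - edgep a b w.
  move=> ha hb hax hby x0; rewrite ler_norml => /andP[y1 y2].
  have Z0 := dyadZ_gt0 R a b w; have Z1 := dyadZ_gt0 R (a + x) (b + y) w.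
  have -> : edgep (a + x) (b + y) w - edgep a b w =
      ((expR (a + x) + expR (a + x + (b + y) + w)) * dyadZ a b w
       - (expR a + expR (a + b + w)) * dyadZ (a + x) (b + y) w)
      / (dyadZ (a + x) (b + y) w * dyadZ a b w).
    by rewrite /edgep; field; rewrite !lt0r_neq0.
  rewrite ler_pdivlMr ?mulr_gt0 //.
  apply: (@le_trans _ _ (expR a * x)).
    rewrite mulrAC ler_wpM2r //; apply: (@le_trans _ _ (expR (- H))).
      rewrite /c mulrAC ler_pdivrMr ?exprn_gt0 ?mulr_gt0 ?expR_gt0 //.
      by rewrite ler_pM2l ?expR_gt0 // expr2 ler_pM ?(ltW Z0) ?(ltW Z1) // Zle.
    by rewrite ler_expR; move: ha; rewrite ler_norml => /andP[].
  have T1 := expR_ge1Dx x; have T2 : 1 <= expR x by lra.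
  have TE1 : 1 <= expR x * expR y by rewrite -expRD -expR0 ler_expR; lra.
  have TE2 : expR y <= expR x by rewrite ler_expR.
  rewrite /dyadZ !expRD.
  set T := expR x in T1 T2 TE1 TE2 *; set E := expR y in TE1 TE2 *.
  set X := expR a; set Y := expR b; set W := expR w.
  have X0 : 0 < X := expR_gt0 _; have Y0 : 0 < Y := expR_gt0 _.
  have W0 : 0 < W := expR_gt0 _; have E0 : 0 < E := expR_gt0 _.
  (* Cleared of its denominators, the difference is a sum of nonnegative terms. *)
  have -> : (X * T + X * T * (Y * E) * W) * (1 + X + Y + X * Y * W)
     - (X + X * Y * W) * (1 + X * T + Y * E + X * T * (Y * E) * W)
     = X * ((T - 1) + Y * (T - E) + Y * W * (T * E - 1) + Y * Y * E * W * (T - 1)) by ring.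
  rewrite ler_pM2l //.
  have := mulr_ge0 (ltW Y0) (_ : 0 <= T - E).
  have := mulr_ge0 (mulr_ge0 (ltW Y0) (ltW W0)) (_ : 0 <= T * E - 1).
  have := mulr_ge0 (mulr_ge0 (mulr_ge0 (mulr_ge0 (ltW Y0) (ltW Y0)) (ltW E0)) (ltW W0)) (_ : 0 <= T - 1).
  by rewrite !subr_ge0 => /(_ T2) h1 /(_ TE1) h2 /(_ TE2) h3; lra.
have [A0|A0] := leP 0 A.
  have := pos u v A D hu hv huA hvD A0; rewrite (ger0_norm A0) in DA => /(_ DA) h.
  by rewrite expr2 mulrA mulrC ler_wpM2l.
(* For negative [A] the start and end points are exchanged. *)
have := pos (u + A) (v + D) (- A) (- D) huA hvD.
rewrite !addrK normrN (ltr0_norm A0) in DA *.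
move=> /(_ hu hv ltac:(lra) DA) h.
by have := ler_wpM2l (_ : 0 <= - A) h; rewrite oppr_ge0 => /(_ (ltW A0)); nra.
Qed.

(** The pairing is the symmetrized Kullback-Leibler divergence of the two dyad laws. All state
    probabilities being at least [m], it is at least [m] times the sum of squared differences of
    log-probabilities, of which the differences of [u], [v], [w] are linear combinations. *)
Lemma dyad_strongly_monotone (R : realType) (H : R) : exists2 c : R, 0 < c &
  forall u v w u' v' w' : R,
    `|u| <= H -> `|v| <= H -> `|w| <= H -> `|u'| <= H -> `|v'| <= H -> `|w'| <= H ->
    c * ((u - u') ^+ 2 + (v - v') ^+ 2 + (w - w') ^+ 2) <=
    (edgep u v w - edgep u' v' w') * (u - u') + (edgep v u w - edgep v' u' w') * (v - v')
    + (recp u v w - recp u' v' w') * (w - w').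
Proof.
(* The exponents [0], [u], [v], [u + v + w] are at least [- (3 * H)] and the normalizer is at most
   [4 * expR (3 * H)]. *)
pose m : R := expR (- (3 * H)) / (4 * expR (3 * H)).
have m0 : 0 < m by rewrite divr_gt0 ?mulr_gt0 ?expR_gt0.
exists (m / 8) => [|u v w u' v' w' hu hv hw hu' hv' hw']; first by rewrite divr_gt0.
have H0 : 0 <= H by exact: le_trans hu.
have mle (a b c z : R) : `|a| <= H -> `|b| <= H -> `|c| <= H -> - (3 * H) <= z ->
    m <= expR (z - ln (dyadZ a b c)).
  rewrite !ler_norml => /andP[_ ha] /andP[_ hb] /andP[_ hc] hz.
  rewrite expRD expRN lnK ?posrE ?dyadZ_gt0 //.
  rewrite /m ler_pM ?expR_ge0 ?invr_ge0 ?mulr_ge0 ?expR_ge0 ?ler_expR //.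
  rewrite lef_pV2 ?posrE ?dyadZ_gt0 ?mulr_gt0 ?expR_gt0 //.
  have -> : 4 * expR (3 * H) = expR (3 * H) + expR (3 * H) + expR (3 * H) + expR (3 * H) by ring.
  rewrite /dyadZ !lerD ?ler_expR //; try lra.
  by rewrite -[leLHS]expR0 ler_expR; lra.
have mono (a b : R) : m <= expR a -> m <= expR b ->
    m * (a - b) ^+ 2 <= (expR a - expR b) * (a - b).
  have w1 (x y : R) : m <= expR y -> y <= x -> m * (x - y) ^+ 2 <= (expR x - expR y) * (x - y).
    move=> my yx; rewrite expr2 mulrA ler_wpM2r ?subr_ge0 //.
    have -> : expR x = expR y * expR (x - y) by rewrite -expRD addrC subrK.
    have := expR_ge1Dx (x - y); nra.
  move=> ma mb; have [ab|/ltW ba] := leP a b; last exact: w1.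
  have := w1 b a ma ab; lra.
have diff (z z' : R) : - (3 * H) <= z -> - (3 * H) <= z' ->
    let d := z - ln (dyadZ u v w) - (z' - ln (dyadZ u' v' w')) in
    m * d ^+ 2 <= (expR (z - ln (dyadZ u v w)) - expR (z' - ln (dyadZ u' v' w'))) * d.
  by move=> hz hz'; apply: mono; apply: mle.
have b (x : R) : `|x| <= H -> - H <= x by rewrite ler_norml => /andP[].
have low0 : - (3 * H) <= 0 by lra.
have low1 (x : R) : `|x| <= H -> - (3 * H) <= x by move=> /b; lra.
have low3 (x y z : R) : `|x| <= H -> `|y| <= H -> `|z| <= H -> - (3 * H) <= x + y + z.
  by move=> /b + /b + /b; lra.
have h0 := diff 0 0 low0 low0.
have h1 := diff u u' (low1 _ hu) (low1 _ hu').
have h2 := diff v v' (low1 _ hv) (low1 _ hv').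
have h3 := diff _ _ (low3 _ _ _ hu hv hw) (low3 _ _ _ hu' hv' hw').
move: h0 h1 h2 h3; rewrite /= => h0 h1 h2 h3 {diff low0 low1 low3 b mono mle}.
(* The pairing of the two differences is the sum over the four states of
   [(q - q') * (ln q - ln q')]. *)
set L := ln (dyadZ u v w) in h0 h1 h2 h3 *; set L' := ln (dyadZ u' v' w') in h0 h1 h2 h3 *.
have Z0 := dyadZ_gt0 R u v w; have Z0' := dyadZ_gt0 R u' v' w'.
have qE z : expR (z - L) = expR z / dyadZ u v w by rewrite expRD expRN /L lnK ?posrE.
have qE' z : expR (z - L') = expR z / dyadZ u' v' w' by rewrite expRD expRN /L' lnK ?posrE.
have tot : expR (0 - L) + expR (u - L) + expR (v - L) + expR (u + v + w - L) = 1.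
  by rewrite !qE expR0 -!mulrDl divff ?lt0r_neq0.
have tot' : expR (0 - L') + expR (u' - L') + expR (v' - L') + expR (u' + v' + w' - L') = 1.
  by rewrite !qE' expR0 -!mulrDl divff ?lt0r_neq0.
have e1 : edgep u v w = expR (u - L) + expR (u + v + w - L) by rewrite !qE /edgep mulrDl.
have e1' : edgep u' v' w' = expR (u' - L') + expR (u' + v' + w' - L').
  by rewrite !qE' /edgep mulrDl.
have e2 : edgep v u w = expR (v - L) + expR (u + v + w - L).
  by rewrite !qE /edgep dyadZC (addrC v u) mulrDl.
have e2' : edgep v' u' w' = expR (v' - L') + expR (u' + v' + w' - L').
  by rewrite !qE' /edgep dyadZC (addrC v' u') mulrDl.
have e3 : recp u v w = expR (u + v + w - L) by rewrite qE.
have e3' : recp u' v' w' = expR (u' + v' + w' - L') by rewrite qE'.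
rewrite e1 e1' e2 e2' e3 e3'.
move: (expR (0 - L)) (expR (0 - L')) (expR (u - L)) (expR (u' - L')) (expR (v - L)) (expR (v' - L'))
  (expR (u + v + w - L)) (expR (u' + v' + w' - L')) tot tot' h0 h1 h2 h3.
move=> q0 q0' q1 q1' q2 q2' q3 q3' tot tot' h0 h1 h2 h3 {qE qE' e1 e1' e2 e2' e3 e3'}.
set d0 := 0 - L - (0 - L') in h0; set d1 := u - L - (u' - L') in h1.
set d2 := v - L - (v' - L') in h2; set d3 := u + v + w - L - (u' + v' + w' - L') in h3.
have eu : u - u' = d1 - d0 by rewrite /d1 /d0; ring.
have ev : v - v' = d2 - d0 by rewrite /d2 /d0; ring.
have ew : w - w' = d3 - d1 - d2 + d0 by rewrite /d3 /d2 /d1 /d0; ring.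
rewrite eu ev ew.
(* The two differences cost a factor 2 each and the four-term combination a factor 4, hence the
   8. *)
have sq : (d1 - d0) ^+ 2 + (d2 - d0) ^+ 2 + (d3 - d1 - d2 + d0) ^+ 2 <=
    8 * (d0 ^+ 2 + d1 ^+ 2 + d2 ^+ 2 + d3 ^+ 2).
  have := sqr_ge0 (d1 + d0); have := sqr_ge0 (d2 + d0).
  have := sqr_ge0 (d3 + d1); have := sqr_ge0 (d3 + d2); have := sqr_ge0 (d3 - d0).
  have := sqr_ge0 (d1 - d2); have := sqr_ge0 d0; have := sqr_ge0 d1.
  have := sqr_ge0 d2; have := sqr_ge0 d3; rewrite !expr2; lra.
have := ler_wpM2l (ltW m0) sq.
have -> : (q1 + q3 - (q1' + q3')) * (d1 - d0) + (q2 + q3 - (q2' + q3')) * (d2 - d0)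
   + (q3 - q3') * (d3 - d1 - d2 + d0) =
   (q0 - q0') * d0 + (q1 - q1') * d1 + (q2 - q2') * d2 + (q3 - q3') * d3.
  have -> : q0 = 1 - q1 - q2 - q3 by lra.
  have -> : q0' = 1 - q1' - q2' - q3' by lra.
  by ring.
rewrite -mulrA; lra.
Qed.

(** * Concentration of the centred degrees *)

(** Independence of the dyads, as an upper bound for exponential moments. The right side expands
    into a sum over all assignments of two booleans to each ordered pair; graphs account for some of
    these terms, and the others are nonnegative. *)
Lemma mass_prod_le (R : realType) (n : nat) (alpha beta : 'I_n -> R) (rho : R)
    (F : 'I_n -> 'I_n -> bool -> bool -> R) :
  (forall i j x y, 0 <= F i j x y) ->
  \sum_(a : graph n) mass alpha beta rho a
     * \prod_(i : 'I_n) \prod_(j : 'I_n | (i < j)%N) F i j (a (i, j)) (a (j, i))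
  <= \prod_(i : 'I_n) \prod_(j : 'I_n | (i < j)%N) \sum_(x : bool) \sum_(y : bool)
        g x y (alpha i) (beta i) (alpha j) (beta j) rho * F i j x y.
Proof.
move=> F0.
(* Pairs that are not increasing are frozen at [(false, false)], so that the product runs over all
   pairs and distributes over the sums. *)
pose G (p : 'I_n * 'I_n) (z : bool * bool) : R :=
  if (p.1 < p.2)%N then
    g z.1 z.2 (alpha p.1) (beta p.1) (alpha p.2) (beta p.2) rho * F p.1 p.2 z.1 z.2
  else (z == (false, false))%:R.
have G0 p z : 0 <= G p z.
  by rewrite /G; case: ifP => _; rewrite ?ler0n // mulr_ge0 ?g_ge0.
have prod_pair (H : 'I_n * 'I_n -> R) : \prod_p H p = \prod_i \prod_j H (i, j).
  by rewrite (pair_bigA _ (fun i j => H (i, j))); apply: eq_bigr => -[].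
have sum_pair (H : bool * bool -> R) : \sum_z H z = \sum_x \sum_y H (x, y).
  by rewrite (pair_bigA _ (fun i j => H (i, j))); apply: eq_bigr => -[].
have -> : \prod_(i : 'I_n) \prod_(j : 'I_n | (i < j)%N) \sum_(x : bool) \sum_(y : bool)
        g x y (alpha i) (beta i) (alpha j) (beta j) rho * F i j x y
    = \prod_p \sum_z G p z.
  rewrite prod_pair.
  apply: eq_bigr => i _; rewrite big_mkcond /=; apply: eq_bigr => j _.
  rewrite sum_pair /G /=.
  by case: ifP => // _; rewrite !big_bool /= !add0r.
rewrite bigA_distr_bigA /=.
(* [dec] and [enc] translate between assignments and loopless graphs. *)
pose dec (f : {ffun 'I_n * 'I_n -> bool * bool}) : graph n :=
  [ffun p : 'I_n * 'I_n => if (p.1 < p.2)%N then (f p).1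
             else if (p.2 < p.1)%N then (f (p.2, p.1)).2 else false].
pose enc (a : graph n) : {ffun 'I_n * 'I_n -> bool * bool} :=
  [ffun p : 'I_n * 'I_n => if (p.1 < p.2)%N then (a p, a (p.2, p.1)) else (false, false)].
rewrite [leLHS](bigID (fun a : graph n => [forall i : 'I_n, ~~ a (i, i)])) /=.
rewrite [X in _ + X]big1 ?addr0; last first.
  by move=> a /negbTE na; rewrite /mass na mulr0 mul0r.
rewrite (reindex_onto dec enc) /=; last first.
  move=> a /forallP a0; apply/ffunP => -[i j]; rewrite !ffunE /=.
  case: ltngtP => // /val_inj ->; exact/esym/negbTE/a0.
rewrite big_mkcond /=; apply: ler_sum => f _.
case: ifP => [/andP[_ /eqP fE]|_]; last by rewrite prodr_ge0.
have decE (i j : 'I_n) : (i < j)%N -> (dec f (i, j) = (f (i, j)).1) * (dec f (j, i) = (f (i, j)).2).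
  by move=> ij; rewrite !ffunE /= ij ltnNge (ltnW ij).
have -> : \prod_(i : 'I_n) \prod_(j : 'I_n | (i < j)%N) F i j (dec f (i, j)) (dec f (j, i))
   = \prod_(i : 'I_n) \prod_(j : 'I_n | (i < j)%N) F i j (f (i, j)).1 (f (i, j)).2.
  by apply: eq_bigr => i _; apply: eq_bigr => j ij; have [-> ->] := decE _ _ ij.
rewrite /mass mulrAC.
have -> : \prod_(i : 'I_n) \prod_(j : 'I_n | (i < j)%N)
   g (dec f (i, j)) (dec f (j, i)) (alpha i) (beta i) (alpha j) (beta j) rho
   = \prod_(i : 'I_n) \prod_(j : 'I_n | (i < j)%N)
   g (f (i, j)).1 (f (i, j)).2 (alpha i) (beta i) (alpha j) (beta j) rho.
  by apply: eq_bigr => i _; apply: eq_bigr => j ij; have [-> ->] := decE _ _ ij.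
apply: (@le_trans _ _ ((\prod_(i : 'I_n) \prod_(j : 'I_n | (i < j)%N)
   g (f (i, j)).1 (f (i, j)).2 (alpha i) (beta i) (alpha j) (beta j) rho) *
   (\prod_(i : 'I_n) \prod_(j : 'I_n | (i < j)%N) F i j (f (i, j)).1 (f (i, j)).2))).
  rewrite ler_piMr ?lern1 ?leq_b1 // mulr_ge0 // prodr_ge0 // => i _;
    by rewrite prodr_ge0 // => j _; rewrite g_ge0.
rewrite prod_pair -big_split /= le_eqVlt; apply/orP; left; apply/eqP.
apply: eq_bigr => i _; rewrite -big_split /= big_mkcond /=; apply: eq_bigr => j _.
rewrite /G /=; case: ifP => // ij.
by rewrite -fE ffunE /= ij.
Qed.

Lemma mass_ge0 (R : realType) (n : nat) (alpha beta : 'I_n -> R) (rho : R) (a : graph n) :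
  0 <= mass alpha beta rho a.
Proof.
by rewrite /mass mulr_ge0 // prodr_ge0 // => i _; rewrite prodr_ge0 // => j _; rewrite g_ge0.
Qed.

Lemma sum_offdiag (V : nmodType) (n : nat) (d : 'I_n -> 'I_n -> V) :
  \sum_(i : 'I_n) \sum_(j : 'I_n | (i < j)%N) (d i j + d j i)
  = \sum_(i : 'I_n) \sum_(j : 'I_n | j != i) d i j.
Proof.
under eq_bigr do rewrite big_split /=.
rewrite big_split /= [X in _ + X](exchange_big_dep predT) //= -big_split /=.
apply: eq_bigr => i _; rewrite [RHS](bigID (fun j : 'I_n => (i < j)%N)) /=.
congr (_ + _); apply: eq_bigl => j; rewrite -val_eqE /=; by case: ltngtP.
Qed.

(** Moves a sum over the dyads at [i] to increasing pairs, the index set of the independent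
    dyads. *)
Lemma sum_star (R : realType) (n : nat) (i : 'I_n) (h : 'I_n -> R) :
  \sum_(k : 'I_n) \sum_(l : 'I_n | (k < l)%N) ((k == i)%:R * h l + (l == i)%:R * h k)
  = \sum_(j : 'I_n | j != i) h j.
Proof.
rewrite (sum_offdiag _ _ (fun k l => (k == i)%:R * h l)) (bigD1 i) //= [X in _ + X]big1.
  by rewrite addr0; apply: eq_bigr => j _; rewrite eqxx mul1r.
by move=> k /negbTE ki; rewrite big1 // => l _; rewrite ki mul0r.
Qed.

(** A centred dyad term bounded by 1 has exponential moment at most
    [1 + 2 * lam ^+ 2 <= expR (2 * lam ^+ 2)]; the dyads away from [i] contribute a factor 1. *)
Lemma star_mgf (R : realType) (n : nat) (alpha beta : 'I_n -> R) (rho : R)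
    (i : 'I_n) (xi : 'I_n -> bool -> bool -> R) (lam : R) :
  (forall j, \sum_(x : bool) \sum_(y : bool)
     g x y (alpha i) (beta i) (alpha j) (beta j) rho * xi j x y = 0) ->
  (forall j x y, `|xi j x y| <= 1) -> `|lam| <= 2^-1 ->
  \sum_(a : graph n) mass alpha beta rho a
     * expR (lam * \sum_(j : 'I_n | j != i) xi j (a (i, j)) (a (j, i)))
  <= expR (2 * lam ^+ 2 * n%:R).
Proof.
move=> mean0 xi1 lam2.
(* The first boolean of [xi] is always the edge leaving [i], hence the swap when [i] is the larger
   node. *)
pose F k l x y := expR (lam * ((k == i)%:R * xi l x y + (l == i)%:R * xi k y x)).
have dyad j : \sum_(x : bool) \sum_(y : bool)
     g x y (alpha i) (beta i) (alpha j) (beta j) rho * expR (lam * xi j x y)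
     <= expR (2 * lam ^+ 2).
  apply: le_trans (expR_ge1Dx _).
  have q x y : expR (lam * xi j x y) <= 1 + lam * xi j x y + 2 * lam ^+ 2.
    have small : `|lam * xi j x y| <= `|lam| by rewrite normrM ler_piMr.
    apply: le_trans (expR_le_quadratic _ _ _) _; first exact: le_trans small lam2.
    rewrite lerD2l ler_pM2l //.
    by rewrite -(ger0_norm (sqr_ge0 (_ * _))) normrX -(ger0_norm (sqr_ge0 lam)) normrX lerXn2r ?nnegrE.
  apply: (@le_trans _ _ (\sum_(x : bool) \sum_(y : bool)
     g x y (alpha i) (beta i) (alpha j) (beta j) rho * (1 + lam * xi j x y + 2 * lam ^+ 2))).
    by do 2![apply: ler_sum => ? _]; rewrite ler_wpM2l ?g_ge0.
  have -> : \sum_(x : bool) \sum_(y : bool)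
       g x y (alpha i) (beta i) (alpha j) (beta j) rho * (1 + lam * xi j x y + 2 * lam ^+ 2) =
     (\sum_(x : bool) \sum_(y : bool) g x y (alpha i) (beta i) (alpha j) (beta j) rho)
       * (1 + 2 * lam ^+ 2) +
     lam * \sum_(x : bool) \sum_(y : bool)
       g x y (alpha i) (beta i) (alpha j) (beta j) rho * xi j x y.
    by rewrite !big_bool /=; ring.
  by rewrite sum_g mean0 mul1r mulr0 addr0.
have prodF (a : graph n) : expR (lam * \sum_(j : 'I_n | j != i) xi j (a (i, j)) (a (j, i))) =
    \prod_(k : 'I_n) \prod_(l : 'I_n | (k < l)%N) F k l (a (k, l)) (a (l, k)).
  rewrite -(sum_star _ _ i (fun j => xi j (a (i, j)) (a (j, i)))) mulr_sumr expR_sum; apply: eq_bigr => k _.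
  rewrite mulr_sumr expR_sum; apply: eq_bigr => l _; rewrite /F.
  congr expR; congr (_ * _); congr (_ + _).
    by case: eqP => [->|_]; rewrite ?mul0r.
  by case: eqP => [->|_]; rewrite ?mul0r.
under eq_bigr do rewrite prodF.
apply: le_trans (mass_prod_le _ _ _ _ _ _ _) _; first by move=> *; exact: expR_ge0.
apply: (@le_trans _ _ (\prod_(k : 'I_n) \prod_(l : 'I_n | (k < l)%N)
    expR ((k == i)%:R * (2 * lam ^+ 2) + (l == i)%:R * (2 * lam ^+ 2)))); last first.
  under eq_bigr do rewrite -expR_sum.
  rewrite -expR_sum ler_expR (sum_star _ _ _ (fun=> 2 * lam ^+ 2)) sumr_const -[leLHS]mulr_natr.
  apply: ler_wpM2l; first by rewrite mulr_ge0 ?sqr_ge0.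
  by rewrite ler_nat -[leqRHS]card_ord max_card.
have S0 k l : 0 <= \sum_(x : bool) \sum_(y : bool)
    g x y (alpha k) (beta k) (alpha l) (beta l) rho * F k l x y.
  by rewrite sumr_ge0 // => x _; rewrite sumr_ge0 // => y _; rewrite mulr_ge0 ?g_ge0 ?expR_ge0.
apply: ler_prod => k _; rewrite prodr_ge0 //=.
apply: ler_prod => l kl; rewrite S0 //= /F.
have [ki|ki] := eqVneq k i; have [li|li] := eqVneq l i.
- by move: kl; rewrite ki li ltnn.
- rewrite ki mul0r mul1r addr0; apply: le_trans (dyad l).
  by do 2![apply: ler_sum => ? _]; rewrite mul0r mul1r addr0.
- rewrite li mul0r mul1r add0r exchange_big /=; apply: le_trans (dyad k).
  by do 2![apply: ler_sum => ? _]; rewrite mul0r mul1r add0r g_swap.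
rewrite !mul0r addr0 expR0 -[leRHS](sum_g R (alpha k) (beta k) (alpha l) (beta l) rho).
by do 2![apply: ler_sum => ? _]; rewrite !mul0r addr0 mulr0 expR0 mulr1.
Qed.

(** Markov's inequality for [expR (lam * S)] and [expR (- lam * S)]. *)
Lemma star_tail (R : realType) (n : nat) (alpha beta : 'I_n -> R) (rho : R)
    (i : 'I_n) (xi : 'I_n -> bool -> bool -> R) (lam t : R) :
  (forall j, \sum_(x : bool) \sum_(y : bool)
     g x y (alpha i) (beta i) (alpha j) (beta j) rho * xi j x y = 0) ->
  (forall j x y, `|xi j x y| <= 1) -> 0 <= lam <= 2^-1 ->
  Prob alpha beta rho
    [pred a : graph n | t < `|\sum_(j : 'I_n | j != i) xi j (a (i, j)) (a (j, i))|]
  <= 2 * expR (2 * lam ^+ 2 * n%:R - lam * t).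
Proof.
move=> mean0 xi1 /andP[lam0 lam2].
pose S (a : graph n) := \sum_(j : 'I_n | j != i) xi j (a (i, j)) (a (j, i)).
have mgf l : `|l| = lam -> \sum_(a : graph n) mass alpha beta rho a * expR (l * S a)
    <= expR (2 * lam ^+ 2 * n%:R).
  move=> ll; have := star_mgf R n alpha beta rho i xi l mean0 xi1; rewrite ll => /(_ lam2).
  by rewrite -ll real_normK ?num_real.
have m1 := mgf lam (ger0_norm lam0).
have m2 : _ <= _ := mgf (- lam) (etrans (normrN _) (ger0_norm lam0)).
apply: (@le_trans _ _ (expR (- (lam * t)) *
  (\sum_(a : graph n) mass alpha beta rho a * expR (lam * S a)
   + \sum_(a : graph n) mass alpha beta rho a * expR (- lam * S a)))); last first.
  by rewrite expRD; have := expR_gt0 (- (lam * t)); nra.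
rewrite /Prob big_mkcond -big_split /= mulr_sumr; apply: ler_sum => a _.
rewrite -/(S a); have w0 := mass_ge0 R n alpha beta rho a; case: ifP => [tS|_]; last first.
  by rewrite -mulrDr (mulr_ge0 (expR_ge0 _)) // (mulr_ge0 w0) // addr_ge0 ?expR_ge0.
rewrite -mulrDr mulrCA ler_peMr // mulrDr -!expRD.
have e1 := expR_ge0 (- (lam * t) + lam * S a).
have e2 := expR_ge0 (- (lam * t) + - lam * S a).
have [S0|S0] := leP 0 (S a).
  have : expR 0 <= expR (- (lam * t) + lam * S a).
    by rewrite ler_expR; move: tS; rewrite ger0_norm //; nra.
  rewrite expR0; lra.
have : expR 0 <= expR (- (lam * t) + - lam * S a).
  by rewrite ler_expR; move: tS; rewrite ltr0_norm //; nra.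
rewrite expR0; lra.
Qed.

(** * First-order conditions at the estimator *)

Lemma offdiagC (V : nmodType) (n : nat) (d : 'I_n -> 'I_n -> V) :
  \sum_(i : 'I_n) \sum_(j : 'I_n | j != i) d i j
  = \sum_(i : 'I_n) \sum_(j : 'I_n | j != i) d j i.
Proof.
rewrite (exchange_big_dep predT) //=; apply: eq_bigr => i _.
by apply: eq_bigl => j; rewrite eq_sym.
Qed.

(** The limit of [T <= t * Q] as [t] tends to 0, carried out at one [t] with [t * Q < T]. *)
Lemma le0_of_le_quadratic (R : realType) (T Q t0 : R) :
  0 < t0 -> 0 <= Q -> (forall t, 0 < t <= t0 -> t * T <= t ^+ 2 * Q) -> T <= 0.
Proof.
move=> t00 Q0 h; rewrite leNgt; apply/negP => T0.
have Q1 : 0 < 2 * (Q + 1) by lra.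
pose t := Num.min t0 (T / (2 * (Q + 1))).
have t1 : 0 < t by rewrite lt_min t00 divr_gt0.
have : t * T <= t ^+ 2 * Q by apply: h; rewrite t1 ge_min lexx.
have : t * (2 * (Q + 1)) <= T by rewrite -ler_pdivlMr // ge_min lexx orbT.
rewrite expr2 -mulrA ler_pM2l //; nra.
Qed.

(** The parameter space is convex, so the segment from the estimator to an admissible point is
    admissible, and the likelihood cannot increase along it to first order. Over ordered pairs each
    reciprocity term occurs twice, hence the [2^-1]. *)
Lemma mle_variational (R : realType) (B : R) (n : nat) (a : graph n)
    (al be al' be' : 'I_n -> R) (rho rho' : R) :
  isMLE B a al be rho -> admissible B al' be' rho' ->
  \sum_(i : 'I_n) \sum_(j : 'I_n | j != i)
    (((a (i, j) : nat)%:R - edgep (al i + be j) (be i + al j) rho)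
        * ((al' i - al i) + (be' j - be j))
     + ((a (i, j) : nat)%:R * (a (j, i) : nat)%:R - recp (al i + be j) (be i + al j) rho)
        * (2^-1 * (rho' - rho))) <= 0.
Proof.
move=> [[hal [hbe [hrho hal0]]] hmax] [hal' [hbe' [hrho' hal0']]].
(* Along the full segment the increments of a dyad add up to at most [4 * B + 4 * B + 2 * B];
   [t <= t0] brings them below [2^-1], as the quadratic bound requires. *)
have B0 : 0 <= B by lra.
pose Q := \sum_(i : 'I_n) \sum_(j : 'I_n | (i < j)%N) (2 * (10 * B) ^+ 2).
have Q0 : 0 <= Q.
  by rewrite sumr_ge0 // => i _; rewrite sumr_ge0 // => j _; rewrite mulr_ge0 ?sqr_ge0.
rewrite -sum_offdiag.
pose t0 := (20 * B + 1)^-1.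
have t00 : 0 < t0 by rewrite invr_gt0; lra.
apply: (le0_of_le_quadratic _ _ _ _ t00 Q0) => t /andP[tp tle].
have tB : t * (20 * B + 1) <= 1 by rewrite -ler_pdivlMr ?mul1r //; lra.
have t1 : t <= 1 by nra.
pose alt i := al i + t * (al' i - al i).
pose bet i := be i + t * (be' i - be i).
pose rhot := rho + t * (rho' - rho).
have conv (x y : R) : - B <= x <= B -> - B <= y <= B -> - B <= x + t * (y - x) <= B.
  by move=> /andP[x1 x2] /andP[y1 y2]; apply/andP; split; nra.
have adm : admissible B alt bet rhot.
  split; first by move=> i; exact: conv.
  split; first by move=> i; exact: conv.
  split; first exact: conv.
  by move=> i i0; rewrite /alt (hal0 _ i0) (hal0' _ i0) subr0 mulr0 addr0.
have hle := hmax alt bet rhot adm; rewrite -subr_le0 /loglik -sumrB in hle.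
rewrite -subr_le0; apply: le_trans hle.
rewrite mulr_sumr /Q mulr_sumr -sumrB; apply: ler_sum => i _.
rewrite mulr_sumr mulr_sumr -!sumrB; apply: ler_sum => j ij.
have dist (x y : R) : - B <= x <= B -> - B <= y <= B -> `|y - x| <= 2 * B.
  by move=> /andP[x1 x2] /andP[y1 y2]; rewrite ler_norml; apply/andP; split; lra.
have d1 := dist _ _ (hal i) (hal' i); have d2 := dist _ _ (hbe j) (hbe' j).
have d3 := dist _ _ (hal j) (hal' j); have d4 := dist _ _ (hbe i) (hbe' i).
have d5 := dist _ _ hrho hrho'.
have := lng_ge_linear R (a (i, j)) (a (j, i)) (al i) (be i) (al j) (be j) rho
          (alt i) (bet i) (alt j) (bet j) rhot.
have E (x y : R) : x + t * (y - x) - x = t * (y - x) by ring.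
rewrite /= /alt /bet /rhot !E -!mulrDr !normrM (gtr0_norm tp) -!mulrDr.
set s := `|_| + `|_| + `|_|.
have s0 : 0 <= s by rewrite /s !addr_ge0.
have s1 : s <= 10 * B.
  rewrite /s; have := ler_normD (al' i - al i) (be' j - be j).
  have := ler_normD (be' i - be i) (al' j - al j); lra.
move=> /(_ ltac:(nra)); apply: le_trans.
rewrite (addrC (be j) (al i)) (addrC (al j) (be i)) (recpC _ (al i + be j)).
have : (t * s) ^+ 2 <= t ^+ 2 * (10 * B) ^+ 2.
  rewrite exprMn ler_wpM2l ?sqr_ge0 // lerXn2r ?nnegrE //; lra.
lra.
Qed.

(** Moving a single coordinate leaves one row or column of the variational inequality. Only a sign
    results, since the estimator may lie on the boundary of the box. *)
Lemma mle_coord_sign (R : realType) (B : R) (n : nat) (a : graph n)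
    (al be al' be' : 'I_n -> R) (rho rho' : R) :
  isMLE B a al be rho -> admissible B al' be' rho' -> forall i : 'I_n,
  0 <= (al i - al' i) * \sum_(j : 'I_n | j != i)
         ((a (i, j) : nat)%:R - edgep (al i + be j) (be i + al j) rho)
  /\ 0 <= (be i - be' i) * \sum_(j : 'I_n | j != i)
         ((a (j, i) : nat)%:R - edgep (al j + be i) (be j + al i) rho).
Proof.
move=> hmle [hal' [hbe' [hrho' hal0']]] i.
have [[hal [hbe [hrho hal0]]] _] := hmle.
split.
  have adm : admissible B (fun k => if k == i then al' k else al k) be rho.
    split; first by move=> k; case: ifP.
    by do 2!split => //; move=> k k0; case: ifP => _; [exact: hal0'|exact: hal0].
  have := mle_variational _ _ _ _ _ _ _ _ _ _ hmle adm.
  rewrite (bigD1 i) //= [X in _ + X]big1 ?addr0 => [|k /negbTE ki].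
    rewrite -oppr_ge0 mulr_sumr -sumrN; congr (0 <= _); apply: eq_bigr => j ji.
    by rewrite eqxx !subrr; ring.
  by rewrite big1 // => j _; rewrite ki !subrr; ring.
have adm : admissible B al (fun k => if k == i then be' k else be k) rho.
  by split=> //; split=> // k; case: ifP.
have := mle_variational _ _ _ _ _ _ _ _ _ _ hmle adm.
rewrite offdiagC (bigD1 i) //= [X in _ + X]big1 ?addr0 => [|k /negbTE ki].
  rewrite -oppr_ge0 mulr_sumr -sumrN; congr (0 <= _); apply: eq_bigr => j ji.
  by rewrite eqxx !subrr; ring.
by rewrite big1 // => j _; rewrite ki !subrr; ring.
Qed.

(** * From average to uniform error bounds *)

(** The bound [|y| <= y ^+ 2 / r + r] takes the place of Cauchy-Schwarz. *)
Lemma sum_norm_le (R : realType) (n : nat) (y : 'I_n -> R) (T r : R) :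
  0 < r -> \sum_i y i ^+ 2 <= T * n%:R * r ^+ 2 ->
  \sum_i `|y i| <= (T + 1) * n%:R * r.
Proof.
move=> r0 hT.
have step i : `|y i| <= r^-1 * (y i) ^+ 2 + r.
  rewrite -real_normK ?num_real //; set z := `|_|.
  rewrite -(ler_pM2l r0) mulrDr mulrA divff ?lt0r_neq0 // mul1r -expr2.
  by have := sqr_ge0 (z - r); have := sqr_ge0 z; have := sqr_ge0 r; lra.
apply: le_trans (ler_sum _ (fun i _ => step i)) _.
rewrite big_split /= -mulr_sumr sumr_const card_ord -mulr_natr.
have := ler_wpM2l (_ : 0 <= r^-1) hT; rewrite invr_ge0 => /(_ (ltW r0)).
have -> : r^-1 * (T * n%:R * r ^+ 2) = T * n%:R * r by field; exact: lt0r_neq0.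
lra.
Qed.

(** A row [i0] with the smallest sum of squares is at most average, so [b j] is near [- a i0]. Then
    [a j] is near [a i0], as [a j - a i0 = (a j + b k) - (b k + a i0)]. *)
Lemma near_constant (R : realType) (n : nat) (a b : 'I_n -> R) (T r : R) :
  (0 < n)%N -> 0 < r ->
  \sum_i \sum_j (a i + b j) ^+ 2 <= T * n%:R ^+ 2 * r ^+ 2 ->
  exists i0, \sum_j `|b j + a i0| <= (T + 1) * n%:R * r /\
             \sum_j `|a j - a i0| <= (4 * T + 1) * n%:R * r.
Proof.
move=> n0 r0 hT; have N0 : 0 < n%:R :> R by rewrite ltr0n.
pose F i := \sum_j (a i + b j) ^+ 2.
have [i0 _ /= hmin] := @arg_minP _ _ _ (Ordinal n0) predT F isT.
have h1 : \sum_j (b j + a i0) ^+ 2 <= T * n%:R * r ^+ 2.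
  rewrite -(ler_pM2r N0); apply: le_trans (_ : \sum_i F i <= _); last by rewrite /F; lra.
  rewrite mulr_natr -[X in _ *+ X](card_ord n) -sumr_const.
  apply: ler_sum => i _; apply: le_trans (hmin i isT).
  by apply: ler_sum => j _; rewrite addrC.
exists i0; split; first exact: sum_norm_le.
apply: sum_norm_le => //; rewrite -(ler_pM2r N0).
have -> : (\sum_j (a j - a i0) ^+ 2) * n%:R = \sum_i \sum_(j : 'I_n) (a i - a i0) ^+ 2.
  by rewrite mulr_suml; apply: eq_bigr => j _; rewrite sumr_const card_ord mulr_natr.
apply: (@le_trans _ _ (\sum_(i : 'I_n) \sum_(j : 'I_n)
   (2 * (a i + b j) ^+ 2 + 2 * (b j + a i0) ^+ 2))).
  apply: ler_sum => i _; apply: ler_sum => j _.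
  have := sqr_ge0 (a i + b j + (b j + a i0)); lra.
under eq_bigr do rewrite big_split /= -!mulr_sumr.
rewrite big_split /= -mulr_sumr sumr_const card_ord -mulr_natr.
have := ler_wpM2r (ltW N0) h1; lra.
Qed.

Lemma lt_norm_sign (R : realDomainType) (z y S : R) :
  `|y| < `|z| -> z * S < 0 -> (z - y) * S < 0.
Proof.
have [z0|z0|->] := ltgtP z 0; last by rewrite mul0r ltxx.
  by rewrite (ltr0_norm z0) ltr_norml => /andP[y1 y2]; nra.
by rewrite (gtr0_norm z0) ltr_norml => /andP[y1 y2]; nra.
Qed.

(* If the common shift [x] were large, every score [S1 i] would have the sign of [x] and
   every score [S2 i] the opposite sign, strictly so at the node [i0] that pins the gauge. *)
Lemma shift_argument (R : realType) (n : nat) (i0 : 'I_n) (A D S1 S2 : 'I_n -> R) (x k s : R) :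
  0 < k -> 0 <= s ->
  (forall i, `|D i| <= `|A i| -> A i * S1 i <= `|A i| * (s - k * `|A i|)) ->
  (forall i, `|A i| <= `|D i| -> D i * S2 i <= `|D i| * (s - k * `|D i|)) ->
  (forall i, 0 <= (A i + x) * S1 i) -> (forall i, 0 <= (D i - x) * S2 i) ->
  A i0 = - x -> \sum_i S1 i = \sum_i S2 i ->
  forall i, `|A i + x| <= 2 * (s / k) /\ `|D i - x| <= 2 * (s / k).
Proof.
move=> k0 s0 hA hD vA vD A0 SE.
(* Beyond the threshold [s / k], a dominant deviation and its score have opposite signs. *)
have neg (z S : R) : s / k < `|z| -> z * S <= `|z| * (s - k * `|z|) -> z * S < 0.
  rewrite ltr_pdivrMr // => h; move/le_lt_trans; apply.
  have : 0 < `|z| by have := normr_ge0 z; nra.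
  nra.
(* If [|x| < |A i|], then [A i + x] has the sign of [A i], and [vA] forbids a score of the opposite
   sign. *)
have conflictA i : `|x| < `|A i| -> A i * S1 i < 0 -> False.
  rewrite -normrN => h1 h2; have := lt_norm_sign _ _ _ _ h1 h2.
  by rewrite opprK ltNge vA.
have conflictD i : `|x| < `|D i| -> D i * S2 i < 0 -> False.
  by move=> h1 h2; have := lt_norm_sign _ _ _ _ h1 h2; rewrite ltNge vD.
have xle : `|x| <= s / k.
  rewrite leNgt; apply/negP => hx.
  have x0 : x != 0.
    by apply: contraTneq hx => ->; rewrite normr0 -leNgt divr_ge0 // ltW.
  have x2 : 0 < x ^+ 2 by rewrite exprn_even_gt0.
  (* Here [A i] is opposite in sign to [x] and at least as large. If it dominates, its score has the
     sign of [x]; otherwise [|D i|] exceeds [|x|], which [conflictD] excludes. *)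
  have keyA i : x * (A i + x) <= 0 -> 0 < x * S1 i.
    move=> xa.
    have Ax : `|x| <= `|A i|.
      by rewrite -ler_sqr ?nnegrE // !real_normK ?num_real //; have := sqr_ge0 (A i + x); nra.
    have [DA|AD] := leP `|D i| `|A i|.
      have AS := neg _ _ (lt_le_trans hx Ax) (hA i DA).
      have xA : x * A i < 0 by rewrite mulrDr -expr2 in xa; lra.
      have A2 : 0 < A i ^+ 2 by rewrite exprn_even_gt0 //; apply: contraTneq xA => ->; rewrite mulr0 ltxx.
      rewrite -(pmulr_lgt0 _ A2).
      have -> : x * S1 i * A i ^+ 2 = x * A i * (A i * S1 i) by ring.
      by rewrite nmulr_rgt0.
    case: (conflictD i); first exact: le_lt_trans AD.
    by apply: neg (hD i (ltW AD)); exact: lt_trans (le_lt_trans Ax AD).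
  have keyD i : 0 <= x * (D i - x) -> x * S2 i < 0.
    move=> xb.
    have Dx : `|x| <= `|D i|.
      by rewrite -ler_sqr ?nnegrE // !real_normK ?num_real //; have := sqr_ge0 (D i - x); nra.
    have [AD|DA] := leP `|A i| `|D i|.
      have DS := neg _ _ (lt_le_trans hx Dx) (hD i AD).
      have xD : 0 < x * D i by rewrite mulrBr -expr2 in xb; lra.
      have D2 : 0 < D i ^+ 2 by rewrite exprn_even_gt0 //; apply: contraTneq xD => ->; rewrite mulr0 ltxx.
      rewrite -(pmulr_llt0 _ D2).
      have -> : x * S2 i * D i ^+ 2 = x * D i * (D i * S2 i) by ring.
      by rewrite pmulr_rlt0.
    case: (conflictA i); first exact: le_lt_trans DA.
    by apply: neg (hA i (ltW DA)); exact: lt_trans (le_lt_trans Dx DA).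
  (* In the remaining case the error has the sign of [x], and [vA] passes it on to the score. *)
  have posA i : 0 <= x * S1 i.
    have [/keyA/ltW//|xa] := leP (x * (A i + x)) 0.
    have h : 0 <= (x * (A i + x)) * (x * S1 i).
      by rewrite mulrACA -expr2 mulr_ge0 ?vA // ltW.
    by rewrite -(pmulr_rge0 _ xa).
  have negD i : x * S2 i <= 0.
    have [/keyD/ltW//|xb] := leP 0 (x * (D i - x)).
    have h : 0 <= (x * (D i - x)) * (x * S2 i).
      by rewrite mulrACA -expr2 mulr_ge0 ?vD // ltW.
    by rewrite -(nmulr_rge0 _ xb).
  have : 0 < x * \sum_i S1 i.
    rewrite mulr_sumr (bigD1 i0) //= ltr_pwDl ?keyA ?A0 ?addNr ?mulr0 //.
    by rewrite sumr_ge0.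
  by rewrite SE mulr_sumr ltNge sumr_le0.
(* The larger deviation, if beyond [s / k], would exceed [|x|] and meet the same conflict. *)
have small (i : 'I_n) : `|A i| <= s / k /\ `|D i| <= s / k.
  have [DA|/ltW AD] := leP `|D i| `|A i|.
    suff Ak : `|A i| <= s / k by split=> //; exact: le_trans Ak.
    rewrite leNgt; apply/negP => h; apply: (conflictA i); first exact: le_lt_trans h.
    exact: neg (hA i DA).
  suff Dk : `|D i| <= s / k by split=> //; exact: le_trans Dk.
  rewrite leNgt; apply/negP => h; apply: (conflictD i); first exact: le_lt_trans h.
  exact: neg (hD i AD).
move=> i; have [hAi hDi] := small i.
have := ler_normD (A i) x; have := ler_normB (D i) x; split; lra.
Qed.

(** The drift of the edge probabilities splits into the common move [(A, D)], handled by dominance,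
    and individual perturbations with a Lipschitz effect. Only sums of the latter over [j] enter, so
    average bounds control every single row. *)
Lemma row_drift (R : realType) (H c : R) (n : nat) (i : 'I_n) (e u v y z : 'I_n -> R)
    (w w' A D : R) :
  (forall u v w A D : R, `|u| <= H -> `|v| <= H -> `|w| <= H ->
    `|u + A| <= H -> `|v + D| <= H -> `|D| <= `|A| ->
    c * A ^+ 2 <= A * (edgep (u + A) (v + D) w - edgep u v w)) ->
  (forall j, `|u j| <= H) -> (forall j, `|v j| <= H) -> `|w| <= H ->
  (forall j, `|u j + A| <= H) -> (forall j, `|v j + D| <= H) -> `|D| <= `|A| ->
  A * \sum_(j : 'I_n | j != i)
        (e j - (edgep (u j + A + y j) (v j + D + z j) w' - edgep (u j) (v j) w))
  <= `|A| * (`|\sum_(j : 'I_n | j != i) e j|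
             + 2 * (\sum_j `|y j| + \sum_j `|z j| + n%:R * `|w' - w|)
             - c * (n%:R - 1) * `|A|).
Proof.
move=> dom hu hv hw huA hvD DA.
rewrite sumrB mulrBr.
have t1 : A * \sum_(j < n | j != i) e j <= `|A| * `|\sum_(j < n | j != i) e j|.
  by rewrite -normrM ler_norm.
have t2 j : c * A ^+ 2 - `|A| * (2 * (`|y j| + `|z j| + `|w' - w|)) <=
    A * (edgep (u j + A + y j) (v j + D + z j) w' - edgep (u j) (v j) w).
  have := dom (u j) (v j) w A D (hu j) (hv j) hw (huA j) (hvD j) DA.
  have := edgep_lipschitz R (u j + A + y j) (v j + D + z j) w' (u j + A) (v j + D) w.
  set p := edgep _ _ w'; set q := edgep (u j + A) (v j + D) w.
  rewrite (addrC (u j + A)) (addrC (v j + D)) !addrK => h.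
  have hA : `|A * (p - q)| <= `|A| * (2 * (`|y j| + `|z j| + `|w' - w|)).
    by rewrite normrM ler_wpM2l.
  by move: hA; rewrite ler_norml => /andP[hA _]; lra.
have n0 : (0 < n)%N by exact: leq_ltn_trans (ltn_ord i).
have t3 : c * A ^+ 2 * (n%:R - 1) - `|A| * (2 * (\sum_j `|y j| + \sum_j `|z j| + n%:R * `|w' - w|))
   <= A * \sum_(j < n | j != i) (edgep (u j + A + y j) (v j + D + z j) w' - edgep (u j) (v j) w).
  rewrite mulr_sumr; apply: le_trans (ler_sum _ (fun j _ => t2 j)).
  rewrite sumrB sumr_const -mulr_sumr -mulr_sumr.
  have -> : #|(fun j : 'I_n => j != i)| = n.-1 by rewrite -[in RHS](card_ord n) (cardC1 i).
  rewrite -[X in _ <= X - _]mulr_natr -subn1 natrB // lerB // ler_wpM2l //.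
  have -> : \sum_j `|y j| + \sum_j `|z j| + n%:R * `|w' - w|
      = \sum_j (`|y j| + `|z j| + `|w' - w|).
    by rewrite !big_split /= sumr_const card_ord mulr_natl.
  by rewrite ler_pM2l // [leRHS](bigD1 i) //= ler_wpDl // !addr_ge0.
rewrite -(real_normK (num_real A)) in t3; lra.
Qed.

(** * Error bounds for the estimator when the noise is small *)

Definition escore {R : realType} {n : nat} (a : graph n) (al be : 'I_n -> R) (rho : R)
    (i j : 'I_n) : R :=
  (a (i, j) : nat)%:R - edgep (al i + be j) (be i + al j) rho.

Definition rscore {R : realType} {n : nat} (a : graph n) (al be : 'I_n -> R) (rho : R)
    (i j : 'I_n) : R :=
  (a (i, j) : nat)%:R * (a (j, i) : nat)%:R - recp (al i + be j) (be i + al j) rho.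

Lemma sum_mul_le (R : realType) (n : nat) (x S : 'I_n -> R) (X Y : R) :
  (forall i, `|x i| <= X) -> (forall i, `|S i| <= Y) ->
  \sum_i x i * S i <= n%:R * (X * Y).
Proof.
move=> hx hS; rewrite -[n in n%:R]card_ord mulr_natl -sumr_const.
apply: ler_sum => i _; apply: le_trans (ler_norm _) _.
by rewrite normrM ler_pM.
Qed.

(** The variational inequality towards the true parameter bounds the strongly monotone pairing by
    errors, at most [2 * B], times row and column sums of the noise. The scale [r] will be
    [n^(-1/8)]. *)
Lemma mle_l2 (R : realType) (B K : R) : 0 < B -> 0 <= K ->
  exists2 C : R, 0 <= C &
  forall (n : nat) (a : graph n) (als bes al be : 'I_n -> R) (rhos rho r : R),
  (1 < n)%N -> 0 < r -> 1 <= n%:R * r ^+ 2 ->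
  admissible B als bes rhos -> isMLE B a al be rho ->
  (forall i, `|\sum_(j : 'I_n | j != i) escore a als bes rhos i j| <= K * n%:R * r ^+ 2) ->
  (forall i, `|\sum_(j : 'I_n | j != i) escore a als bes rhos j i| <= K * n%:R * r ^+ 2) ->
  (forall i, `|\sum_(j : 'I_n | j != i) rscore a als bes rhos i j| <= K * n%:R * r ^+ 2) ->
  \sum_i \sum_j ((al i - als i) + (be j - bes j)) ^+ 2 <= C * n%:R ^+ 2 * r ^+ 2
  /\ (rho - rhos) ^+ 2 <= C * r ^+ 2.
Proof.
move=> B0 K0; have [c c0 mono] := dyad_strongly_monotone R (2 * B).
exists (20 * B * K / c + 16 * B ^+ 2).
  by rewrite addr_ge0 ?mulr_ge0 ?invr_ge0 ?sqr_ge0 // ltW.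
move=> n a als bes al be rhos rho r n1 r0 nr adms hmle nout nin nrec.
have [[hals [hbes [hrhos _]]] [[hal [hbe [hrho _]]] _]] := (adms, hmle).
have N0 : 0 < n%:R :> R by rewrite ltr0n ltnW.
set da := fun i => al i - als i; set db := fun i => be i - bes i.
set dr := rho - rhos.
pose dp i j := edgep (al i + be j) (be i + al j) rho - edgep (als i + bes j) (bes i + als j) rhos.
pose dq i j := recp (al i + be j) (be i + al j) rho - recp (als i + bes j) (bes i + als j) rhos.
have dist (x y : R) : - B <= x <= B -> - B <= y <= B -> `|y - x| <= 2 * B.
  by move=> /andP[x1 x2] /andP[y1 y2]; rewrite ler_norml; apply/andP; split; lra.
have sum2 (x y : R) : - B <= x <= B -> - B <= y <= B -> `|x + y| <= 2 * B.
  by move=> /andP[x1 x2] /andP[y1 y2]; rewrite ler_norml; apply/andP; split; lra.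
have one (x : R) : - B <= x <= B -> `|x| <= 2 * B.
  by move=> /andP[x1 x2]; rewrite ler_norml; apply/andP; split; lra.
pose Q i j := (da i + db j) ^+ 2 + (db i + da j) ^+ 2 + dr ^+ 2.
pose Kn := K * n%:R * r ^+ 2.
(* Strong monotonicity concerns both edges of a dyad at once, so the sum is symmetrized over
   [(i, j)] and [(j, i)]. *)
have lower : c * \sum_i \sum_(j : 'I_n | j != i) Q i j <=
    2 * \sum_i \sum_(j : 'I_n | j != i) (dp i j * (da i + db j) + dq i j * (2^-1 * dr)).
  have -> : 2 * \sum_i \sum_(j : 'I_n | j != i) (dp i j * (da i + db j) + dq i j * (2^-1 * dr))
    = \sum_i \sum_(j : 'I_n | j != i)
       (dp i j * (da i + db j) + dp j i * (da j + db i) + dq i j * dr).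
    rewrite mulr_natl mulr2n [X in _ + X]offdiagC -big_split /=; apply: eq_bigr => i _.
    rewrite -big_split /=; apply: eq_bigr => j _.
    have -> : dq j i = dq i j.
      rewrite /dq recpC [X in _ - X]recpC.
      by rewrite (addrC (be j)) (addrC (al j)) (addrC (bes j)) (addrC (als j)).
    by field.
  rewrite mulr_sumr; apply: ler_sum => i _; rewrite mulr_sumr; apply: ler_sum => j _.
  have := mono _ _ _ _ _ _ (sum2 _ _ (hal i) (hbe j)) (sum2 _ _ (hbe i) (hal j)) (one _ hrho)
    (sum2 _ _ (hals i) (hbes j)) (sum2 _ _ (hbes i) (hals j)) (one _ hrhos).
  have -> : al i + be j - (als i + bes j) = da i + db j by rewrite /da /db; ring.
  have -> : be i + al j - (bes i + als j) = db i + da j by rewrite /da /db; ring.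
  rewrite -/dr -/(Q i j) -/(dp i j) -/(dq i j) (addrC (da j)). move=> hm; apply: le_trans hm _.
  by rewrite /dp (addrC (al j)) (addrC (be j)) (addrC (als j)) (addrC (bes j)).
(* The score at the estimator is noise minus drift; the three noise terms cost [2 * B], [2 * B] and
   [B]. *)
have upper : \sum_i \sum_(j : 'I_n | j != i) (dp i j * (da i + db j) + dq i j * (2^-1 * dr))
    <= 5 * B * n%:R * Kn.
  have := mle_variational _ _ _ _ _ _ _ _ _ _ hmle adms.
  have -> : \sum_i \sum_(j : 'I_n | j != i)
    (((a (i, j) : nat)%:R - edgep (al i + be j) (be i + al j) rho)
        * ((als i - al i) + (bes j - be j))
     + ((a (i, j) : nat)%:R * (a (j, i) : nat)%:R - recp (al i + be j) (be i + al j) rho)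
        * (2^-1 * (rhos - rho))) =
    \sum_i \sum_(j : 'I_n | j != i) (dp i j * (da i + db j) + dq i j * (2^-1 * dr))
    - (\sum_i da i * \sum_(j : 'I_n | j != i) escore a als bes rhos i j
       + \sum_i db i * \sum_(j : 'I_n | j != i) escore a als bes rhos j i
       + \sum_i (2^-1 * dr) * \sum_(j : 'I_n | j != i) rscore a als bes rhos i j).
    have -> : \sum_i db i * \sum_(j : 'I_n | j != i) escore a als bes rhos j i =
       \sum_i \sum_(j : 'I_n | j != i) db j * escore a als bes rhos i j.
      by rewrite offdiagC; apply: eq_bigr => i _; rewrite mulr_sumr.
    rewrite -!big_split /= -sumrB; apply: eq_bigr => i _.
    rewrite !mulr_sumr -!big_split /= -sumrB; apply: eq_bigr => j _.
    by rewrite /dp /dq /da /db /dr /escore /rscore; ring.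
  have b1 := sum_mul_le R n da _ (2 * B) Kn (fun i => dist _ _ (hals i) (hal i)) nout.
  have b2 := sum_mul_le R n db _ (2 * B) Kn (fun i => dist _ _ (hbes i) (hbe i)) nin.
  have hdr : `|2^-1 * dr| <= B.
    by have := dist _ _ hrhos hrho; rewrite normrM gtr0_norm ?invr_gt0 // -/dr; lra.
  have b3 := sum_mul_le R n (fun=> 2^-1 * dr) _ B Kn (fun=> hdr) nrec.
  lra.
have Qbound : \sum_i \sum_(j : 'I_n | j != i) Q i j <= 10 * B * K / c * n%:R ^+ 2 * r ^+ 2.
  rewrite -(ler_pM2l c0); apply: le_trans lower _.
  have -> : c * (10 * B * K / c * n%:R ^+ 2 * r ^+ 2) = 2 * (5 * B * n%:R * Kn).
    by rewrite /Kn; field; exact: lt0r_neq0.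
  by rewrite ler_pM2l.
have C0 : 0 <= 10 * B * K / c.
  by rewrite !mulr_ge0 ?invr_ge0 // ltW.
have B2 := sqr_ge0 B; have r2 := sqr_ge0 r.
split.
  (* The diagonal, absent from the likelihood, is absorbed through [1 <= n%:R * r ^+ 2]. *)
  have diag i : (da i + db i) ^+ 2 <= 16 * B ^+ 2.
    have := dist _ _ (hals i) (hal i); have := dist _ _ (hbes i) (hbe i).
    rewrite -/(da i) -/(db i) !ler_norml => /andP[h1 h2] /andP[h3 h4]; nra.
  have off i : \sum_j (da i + db j) ^+ 2 <= 16 * B ^+ 2 + \sum_(j : 'I_n | j != i) Q i j.
    rewrite (bigD1 i) //= lerD // ler_sum // => j _.
    by have := sqr_ge0 (db i + da j); have := sqr_ge0 dr; rewrite /Q; lra.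
  apply: le_trans (ler_sum _ (fun i _ => off i)) _.
  rewrite big_split /= sumr_const card_ord -[X in X + _]mulr_natr.
  have : n%:R <= n%:R ^+ 2 * r ^+ 2 :> R.
    by rewrite expr2 -mulrA ler_peMr // ltW.
  have : 0 <= n%:R ^+ 2 * r ^+ 2 :> R by rewrite mulr_ge0 ?sqr_ge0.
  set z := n%:R ^+ 2 * r ^+ 2; rewrite -![_ * n%:R ^+ 2 * _]mulrA -/z in Qbound *.
  nra.
(* [dr ^+ 2] occurs in all [n (n - 1) >= n^2 / 2] ordered pairs. *)
have low : n%:R ^+ 2 * dr ^+ 2 <= 2 * \sum_i \sum_(j : 'I_n | j != i) Q i j.
  apply: (@le_trans _ _ (2 * \sum_(i : 'I_n) \sum_(j : 'I_n | j != i) dr ^+ 2)); last first.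
    rewrite ler_pM2l //; apply: ler_sum => i _; apply: ler_sum => j _.
    by have := sqr_ge0 (db i + da j); have := sqr_ge0 (da i + db j); rewrite /Q; lra.
  have const (x : R) : \sum_(j : 'I_n) x = n%:R * x.
    by rewrite sumr_const card_ord mulr_natl.
  have -> : \sum_(i : 'I_n) \sum_(j : 'I_n | j != i) dr ^+ 2 = n%:R * ((n%:R - 1) * dr ^+ 2).
    rewrite -const; apply: eq_bigr => i _.
    by have := const (dr ^+ 2); rewrite (bigD1 i) //=; lra.
  have N2 : 2 <= n%:R :> R by rewrite ler_nat.
  have := mulr_ge0 (mulr_ge0 (sqr_ge0 dr) (ltW N0)) (_ : 0 <= n%:R - 2).
  rewrite subr_ge0 => /(_ N2); lra.
have N2 : 0 < n%:R ^+ 2 :> R by rewrite exprn_gt0.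
rewrite -(ler_pM2l N2); apply: le_trans low _.
have := mulr_ge0 (mulr_ge0 B2 (ltW N2)) r2; lra.
Qed.

(** The average bound yields a shift [x] with mean deviations of order [r]; [row_drift] turns these
    into the hypotheses of [shift_argument], with [s / k] of order [r]. *)
Lemma mle_sup_bound (R : realType) (B K : R) : 0 < B -> 0 <= K ->
  exists2 C : R, 0 <= C &
  forall (n : nat) (a : graph n) (als bes al be : 'I_n -> R) (rhos rho r : R),
  (1 < n)%N -> 0 < r <= 1 -> 1 <= n%:R * r ^+ 2 ->
  admissible B als bes rhos -> isMLE B a al be rho ->
  (forall i, `|\sum_(j : 'I_n | j != i) escore a als bes rhos i j| <= K * n%:R * r ^+ 2) ->
  (forall i, `|\sum_(j : 'I_n | j != i) escore a als bes rhos j i| <= K * n%:R * r ^+ 2) ->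
  (forall i, `|\sum_(j : 'I_n | j != i) rscore a als bes rhos i j| <= K * n%:R * r ^+ 2) ->
  forall i, `|al i - als i| <= C * r /\ `|be i - bes i| <= C * r.
Proof.
move=> B0 K0; have [T T0 l2] := mle_l2 R B K B0 K0.
(* As [|x| <= 2 * B], the shifted arguments are at most [4 * B] in absolute value, within the radius
   [6 * B]. *)
have [c c0 dom] := edgep_dominance R (6 * B).
(* The noise gives [K]; the deviations of [db], [da] and [rho] give [T + 1], [4 * T + 1] and
   [T + 1], doubled by the Lipschitz constant. *)
pose q := K + 2 * (6 * T + 3).
have q0 : 0 <= q by rewrite /q; lra.
have small (z : R) : - B <= z <= B -> `|z| <= 6 * B.
  by move=> /andP[z1 z2]; rewrite ler_norml; apply/andP; split; lra.
have sum2 (y z : R) : - B <= y <= B -> - B <= z <= B -> `|y + z| <= 6 * B.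
  by move=> /andP[y1 y2] /andP[z1 z2]; rewrite ler_norml; apply/andP; split; lra.
have shift (y p p' z : R) : - B <= y <= B -> - B <= p <= B -> - B <= p' <= B ->
    - (2 * B) <= z <= 2 * B -> `|p + y + (p' - p + z)| <= 6 * B.
  move=> /andP[? ?] /andP[? ?] /andP[? ?] /andP[? ?].
  by rewrite ler_norml; apply/andP; split; lra.
exists (4 * q / c); first by rewrite !mulr_ge0 ?invr_ge0 // ltW.
move=> n a als bes al be rhos rho r n1 /andP[r0 r1] nr adms hmle nout nin nrec.
have [l2ab l2r] := l2 n a als bes al be rhos rho r n1 r0 nr adms hmle nout nin nrec.
have [[hals [hbes [hrhos hals0]]] [[hal [hbe [hrho hal0]]] _]] := (adms, hmle).
have N0 : 0 < n%:R :> R by rewrite ltr0n ltnW.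
have N2 : 2 <= n%:R :> R by rewrite ler_nat.
pose da i := al i - als i; pose db i := be i - bes i.
have [i0 []] := near_constant R n da db T r (ltnW n1) r0 l2ab.
set x := da i0 => l1b l1a.
have l1r : `|rho - rhos| <= (T + 1) * r.
  rewrite -ler_sqr ?nnegrE ?mulr_ge0 ?addr_ge0 ?(ltW r0) // real_normK ?num_real //.
  by apply: le_trans l2r _; rewrite exprMn ler_wpM2r ?sqr_ge0 //; nra.
pose S1 i := \sum_(j : 'I_n | j != i)
  ((a (i, j) : nat)%:R - edgep (al i + be j) (be i + al j) rho).
pose S2 i := \sum_(j : 'I_n | j != i)
  ((a (j, i) : nat)%:R - edgep (al j + be i) (be j + al i) rho).
pose A i := da i - x; pose D i := db i + x.
pose k := c * (n%:R - 1); pose s := q * n%:R * r.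
have [x1 x2] : - (2 * B) <= x /\ x <= 2 * B.
  by have /andP[? ?] := hal i0; have /andP[? ?] := hals i0; rewrite /x /da; split; lra.
have shiftA i (y : R) : - B <= y <= B -> `|als i + y + A i| <= 6 * B.
  by move=> hy; apply: shift => //; rewrite lerN2 lerNl x1 x2.
have shiftD i (y : R) : - B <= y <= B -> `|bes i + y + D i| <= 6 * B.
  by move=> hy; apply: shift => //; rewrite x1.
have total (S : R) : `|S| <= K * n%:R * r ^+ 2 ->
    `|S| + 2 * (\sum_j `|db j + x| + \sum_j `|da j - x| + n%:R * `|rho - rhos|) <= s.
  move=> hS.
  have : K * n%:R * r ^+ 2 <= K * n%:R * r.
    by rewrite ler_wpM2l ?mulr_ge0 ?(ltW N0) // expr2 ler_piMr // ltW.
  have := ler_wpM2l (ltW N0) l1r; rewrite /s /q; lra.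
have hA i : `|D i| <= `|A i| -> A i * S1 i <= `|A i| * (s - k * `|A i|).
  move=> DA.
  have := row_drift R (6 * B) c n i (escore a als bes rhos i)
    (fun j => als i + bes j) (fun j => bes i + als j) (fun j => db j + x) (fun j => da j - x)
    rhos rho (A i) (D i) dom (fun j => sum2 _ _ (hals i) (hbes j))
    (fun j => sum2 _ _ (hbes i) (hals j)) (small _ hrhos)
    (fun j => shiftA i _ (hbes j)) (fun j => shiftD i _ (hals j)) DA.
  have -> : S1 i = \sum_(j < n | j != i) (escore a als bes rhos i j -
     (edgep (als i + bes j + A i + (db j + x)) (bes i + als j + D i + (da j - x)) rho
      - edgep (als i + bes j) (bes i + als j) rhos)).
    apply: eq_bigr => j _; rewrite /escore.
    have -> : als i + bes j + A i + (db j + x) = al i + be j by rewrite /A /da /db; ring.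
    have -> : bes i + als j + D i + (da j - x) = be i + al j by rewrite /D /da /db; ring.
    by ring.
  move/le_trans; apply; rewrite ler_wpM2l // /k lerD2r; exact: total (nout i).
(* For incoming edges the two arguments of [edgep] exchange roles. *)
have hD i : `|A i| <= `|D i| -> D i * S2 i <= `|D i| * (s - k * `|D i|).
  move=> AD.
  have := row_drift R (6 * B) c n i (fun j => escore a als bes rhos j i)
    (fun j => bes i + als j) (fun j => als i + bes j) (fun j => da j - x) (fun j => db j + x)
    rhos rho (D i) (A i) dom (fun j => sum2 _ _ (hbes i) (hals j))
    (fun j => sum2 _ _ (hals i) (hbes j)) (small _ hrhos)
    (fun j => shiftD i _ (hals j)) (fun j => shiftA i _ (hbes j)) AD.
  have -> : S2 i = \sum_(j < n | j != i) (escore a als bes rhos j i -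
     (edgep (bes i + als j + D i + (da j - x)) (als i + bes j + A i + (db j + x)) rho
      - edgep (bes i + als j) (als i + bes j) rhos)).
    apply: eq_bigr => j _; rewrite /escore.
    have -> : als i + bes j + A i + (db j + x) = be j + al i by rewrite /A /da /db; ring.
    have -> : bes i + als j + D i + (da j - x) = al j + be i by rewrite /D /da /db; ring.
    by rewrite (addrC (bes i)) (addrC (als i)); ring.
  move/le_trans; apply; rewrite ler_wpM2l // /k lerD2r.
  by rewrite (addrC (\sum_j `|da j - x|)); exact: total (nin i).
have AxE i : A i + x = da i by rewrite subrK.
have DxE i : D i - x = db i by rewrite addrK.
have vA i : 0 <= (A i + x) * S1 i.
  by rewrite AxE; have [] := mle_coord_sign _ _ _ _ _ _ _ _ _ _ hmle adms i.
have vD i : 0 <= (D i - x) * S2 i.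
  by rewrite DxE; have [] := mle_coord_sign _ _ _ _ _ _ _ _ _ _ hmle adms i.
have A0 : A (Ordinal (ltnW n1)) = - x by rewrite /A /da hal0 // hals0 // subrr add0r.
have k0 : 0 < k by rewrite mulr_gt0 //; lra.
have s0 : 0 <= s by rewrite /s !mulr_ge0 ?(ltW N0) ?(ltW r0).
(* The two total scores agree: each ordered pair is counted once, by tail or by head. *)
have := shift_argument R n _ A D S1 S2 x k s k0 s0 hA hD vA vD A0 (offdiagC _ _ _).
have sk : 2 * (s / k) <= 4 * q / c * r.
  have -> : 4 * q / c * r = 2 * (2 * q * r / c) by field; exact: lt0r_neq0.
  rewrite ler_pM2l // ler_pdivrMr //.
  have -> : 2 * q * r / c * k = 2 * q * r * (n%:R - 1) by rewrite /k; field; exact: lt0r_neq0.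
  have qr : 0 <= q * r by rewrite mulr_ge0 // ltW.
  rewrite /s; nra.
move=> h i; have [h1 h2] := h i; rewrite AxE DxE in h1 h2.
by split; apply: le_trans sk.
Qed.

(** * Probability of large noise *)

(** The threshold is [K * n^(3/4)], well above the scale [n^(1/2)] of the noise. The exponential
    tail is weakened to order [1 / n], which suits a union bound over the nodes. *)
Lemma noise_tail (R : realType) (n : nat) (alpha beta : 'I_n -> R) (rho K r : R) (i : 'I_n)
    (xi : 'I_n -> bool -> bool -> R) :
  (forall j, \sum_(x : bool) \sum_(y : bool)
     g x y (alpha i) (beta i) (alpha j) (beta j) rho * xi j x y = 0) ->
  (forall j x y, `|xi j x y| <= 1) -> 0 < K -> 0 < r <= 1 -> n%:R * r ^+ 8 = 1 ->
  Prob alpha beta rho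
    [pred a : graph n | K * n%:R * r ^+ 2 < `|\sum_(j : 'I_n | j != i) xi j (a (i, j)) (a (j, i))|]
  <= 2 ^+ 14 / K ^+ 4 / n%:R.
Proof.
(* Chernoff bound at the parameter [1 / (2 * sqrt n) = r ^+ 4 / 2]. *)
move=> mean0 xi1 K0 /andP[r0 r1] nr.
have lam : 0 <= r ^+ 4 / 2 <= 2^-1.
  rewrite divr_ge0 ?exprn_ge0 ?(ltW r0) //= ler_pdivrMr // mulVf ?pnatr_eq0 //.
  by rewrite exprn_ile1 // ltW.
apply: le_trans (star_tail _ _ _ _ _ _ _ _ _ mean0 xi1 lam) _.
have -> : 2 * (r ^+ 4 / 2) ^+ 2 * n%:R = 2^-1 * (n%:R * r ^+ 8) by field.
rewrite nr mulr1.
have r2 : 0 < r ^+ 2 by rewrite exprn_gt0.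
have r8 : 0 < r ^+ 8 by rewrite exprn_gt0.
have nE : n%:R = (r ^+ 8)^-1 by apply: (mulIf (lt0r_neq0 r8)); rewrite nr mulVf ?lt0r_neq0.
have -> : r ^+ 4 / 2 * (K * n%:R * r ^+ 2) = 4 * (K / (8 * r ^+ 2)).
  by rewrite nE; field; exact: lt0r_neq0.
set z := K / (8 * r ^+ 2).
have z0 : 0 < z by rewrite divr_gt0 // mulr_gt0.
have e1 : expR 2^-1 <= 2 :> R.
  by apply: le_trans (expR_le_quadratic R 2^-1 _) _; [rewrite gtr0_norm ?invr_gt0|lra].
(* The fourth power is the one for which [z ^+ 4] is proportional to [r ^- 8 = n]. *)
have e2 : z ^+ 4 <= expR (4 * z).
  rewrite expRM_natl lerXn2r ?nnegrE ?expR_ge0 ?(ltW z0) //.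
  by have := expR_ge1Dx z; lra.
rewrite expRD expRN.
have e3 : (expR (4 * z))^-1 <= (z ^+ 4)^-1 by rewrite lef_pV2 ?posrE ?exprn_gt0 ?expR_gt0.
have -> : 2 ^+ 14 / K ^+ 4 / n%:R = 2 * (2 * (z ^+ 4)^-1).
  rewrite nE /z; field; rewrite !lt0r_neq0 //.
by rewrite ler_pM2l // ler_pM ?expR_ge0 ?invr_ge0 ?expR_ge0.
Qed.

Lemma centred_mean (R : realType) (f : bool -> bool -> R) (m ai bi aj bj rho : R) :
  \sum_(x : bool) \sum_(y : bool) g x y ai bi aj bj rho * f x y = m ->
  \sum_(x : bool) \sum_(y : bool) g x y ai bi aj bj rho * (f x y - m) = 0.
Proof.
move=> fm.
transitivity (\sum_(x : bool) \sum_(y : bool) g x y ai bi aj bj rho * f x y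
   - m * \sum_(x : bool) \sum_(y : bool) g x y ai bi aj bj rho).
  by rewrite !big_bool /=; ring.
by rewrite fm sum_g mulr1 subrr.
Qed.

Lemma norm_sub_le1 (R : realType) (p q : R) : 0 <= p <= 1 -> 0 <= q <= 1 -> `|p - q| <= 1.
Proof.
by move=> /andP[p0 p1] /andP[q0 q1]; rewrite ler_norml; apply/andP; split; lra.
Qed.

Lemma powR_N8 (R : realType) (n : nat) : (0 < n)%N ->
  let r : R := n%:R `^ (- (8%:R)^-1) in [/\ 0 < r, r <= 1 & n%:R * r ^+ 8 = 1].
Proof.
move=> n0 r; have N0 : 0 < n%:R :> R by rewrite ltr0n.
have r0 : 0 < r by rewrite powR_gt0.
have nr : n%:R * r ^+ 8 = 1.
  rewrite -powR_mulrn ?ltW // -powRrM mulNr mulVf ?pnatr_eq0 //.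
  by rewrite powR_inv1 ?ltW // mulfV // lt0r_neq0.
split=> //; rewrite -(@expr_le1 _ 8 r isT (ltW r0)) -[leRHS]nr.
by rewrite ler_peMl ?ler1n // exprn_ge0 // ltW.
Qed.

(** A union bound over [3 * n] events of probability of order [1 / n]: the bound does not depend on
    [n] and is small for large [K]. *)
Lemma noise_prob (R : realType) (n : nat) (alpha beta : 'I_n -> R) (rho K r : R)
    (E : pred (graph n)) :
  0 < K -> 0 < r <= 1 -> n%:R * r ^+ 8 = 1 ->
  (forall a, E a ->
    ~ ((forall i, `|\sum_(j : 'I_n | j != i) escore a alpha beta rho i j| <= K * n%:R * r ^+ 2) /\
       (forall i, `|\sum_(j : 'I_n | j != i) escore a alpha beta rho j i| <= K * n%:R * r ^+ 2) /\
       (forall i, `|\sum_(j : 'I_n | j != i) rscore a alpha beta rho i j| <= K * n%:R * r ^+ 2))) ->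
  Prob alpha beta rho E <= 3 * 2 ^+ 14 / K ^+ 4.
Proof.
move=> K0 r01 nr hE; set t := K * n%:R * r ^+ 2 in hE.
pose E1 i := [pred a : graph n | t < `|\sum_(j : 'I_n | j != i) escore a alpha beta rho i j|].
pose E2 i := [pred a : graph n | t < `|\sum_(j : 'I_n | j != i) escore a alpha beta rho j i|].
pose E3 i := [pred a : graph n | t < `|\sum_(j : 'I_n | j != i) rscore a alpha beta rho i j|].
have n0 : (0 < n)%N.
  by rewrite lt0n; apply: contra_eq_neq nr => ->; rewrite mul0r eq_sym oner_neq0.
have N0 : 0 < n%:R :> R by rewrite ltr0n.
have unit (b : bool) : 0 <= ((b : nat)%:R : R) <= 1 by case: b; rewrite ?ler01 ?lexx.
have unit2 (b b' : bool) : 0 <= ((b : nat)%:R * (b' : nat)%:R : R) <= 1.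
  by case: b; case: b'; rewrite ?mulr0 ?mul0r ?mulr1 ?ler01 ?lexx.
have p1 i : Prob alpha beta rho (E1 i) <= 2 ^+ 14 / K ^+ 4 / n%:R.
  apply: (noise_tail R n alpha beta rho K r i (fun j x y =>
     (x : nat)%:R - edgep (alpha i + beta j) (beta i + alpha j) rho)) => // [j|j x y].
    exact: (centred_mean R (fun x y => (x : nat)%:R)) (mean_edge _ _ _ _ _ _).
  exact: norm_sub_le1 (unit x) (edgep_bounds _ _ _ _).
have p2 i : Prob alpha beta rho (E2 i) <= 2 ^+ 14 / K ^+ 4 / n%:R.
  apply: (noise_tail R n alpha beta rho K r i (fun j x y =>
     (y : nat)%:R - edgep (alpha j + beta i) (beta j + alpha i) rho)) => // [j|j x y].
    apply: (centred_mean R (fun x y => (y : nat)%:R)).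
    rewrite exchange_big /= -mean_edge; apply: eq_bigr => x _; apply: eq_bigr => y _.
    by rewrite g_swap.
  exact: norm_sub_le1 (unit y) (edgep_bounds _ _ _ _).
have p3 i : Prob alpha beta rho (E3 i) <= 2 ^+ 14 / K ^+ 4 / n%:R.
  apply: (noise_tail R n alpha beta rho K r i (fun j x y =>
     (x : nat)%:R * (y : nat)%:R - recp (alpha i + beta j) (beta i + alpha j) rho))
     => // [j|j x y].
    exact: (centred_mean R (fun x y => (x : nat)%:R * (y : nat)%:R)) (mean_rec _ _ _ _ _ _).
  exact: norm_sub_le1 (unit2 x y) (recp_bounds _ _ _ _).
apply: (@le_trans _ _ (\sum_i (Prob alpha beta rho (E1 i) + Prob alpha beta rho (E2 i)
   + Prob alpha beta rho (E3 i)))); last first.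
  apply: (@le_trans _ _ (\sum_(i : 'I_n) 3 * (2 ^+ 14 / K ^+ 4 / n%:R))).
    by apply: ler_sum => i _; have := p1 i; have := p2 i; have := p3 i; lra.
  rewrite sumr_const card_ord -[leLHS]mulr_natr.
  by rewrite le_eqVlt; apply/orP; left; apply/eqP; field; rewrite !lt0r_neq0.
pose ind (F : pred (graph n)) a := if F a then mass alpha beta rho a else 0.
have w0 a := mass_ge0 R n alpha beta rho a.
have ind0 F a : 0 <= ind F a by rewrite /ind; case: ifP.
have PE F : Prob alpha beta rho F = \sum_a ind F a by rewrite /Prob big_mkcond.
under eq_bigr do rewrite !PE -!big_split /=.
rewrite PE exchange_big /=; apply: ler_sum => a _.
have sub i : 0 <= ind (E1 i) a + ind (E2 i) a + ind (E3 i) a by rewrite !addr_ge0.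
rewrite {1}/ind; case: ifP => Ea; last by rewrite sumr_ge0.
have [i hi] : exists i, [|| E1 i a, E2 i a | E3 i a].
  apply: contrapT => nex; apply: (hE a Ea).
  have no i : [/\ ~~ E1 i a, ~~ E2 i a & ~~ E3 i a].
    by split; apply/negP => h; apply: nex; exists i; rewrite h ?orbT.
  by do 2?split; move=> i; rewrite leNgt; have [] := no i.
rewrite (bigD1 i) //= ler_wpDr ?sumr_ge0 //.
have := ind0 (E1 i) a; have := ind0 (E2 i) a; have := ind0 (E3 i) a.
by move: hi; rewrite /ind => /or3P[] ->; lra.
Qed.

Theorem theorem2 (R : realType) (B : R) (hB : 0 < B)
  (astar bstar : forall n : nat, 'I_n -> R) (rstar : nat -> R)
  (hstar : forall n, admissible B (astar n) (bstar n) (rstar n))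
  (ahat bhat : forall n : nat, graph n -> 'I_n -> R) (rhat : forall n : nat, graph n -> R)
  (hmle : forall n (a : graph n), isMLE B a (ahat n a) (bhat n a) (rhat n a)) :
  forall eps : R, 0 < eps ->
  exists M : R, exists N : nat, forall n : nat, (N <= n)%N ->
    Prob (astar n) (bstar n) (rstar n)
      [pred a : graph n |
        M * rate R n < supnorm (fun i => ahat n a i - astar n i)
                       + supnorm (fun i => bhat n a i - bstar n i)]
    < eps.
Proof.
(* This [K] gives [eps = 3 * 2 ^+ 14 / (K - 1)], and [K ^+ 4 >= K > K - 1]. *)
move=> eps eps0; pose K := 3 * 2 ^+ 14 / eps + 1.
have K1 : 1 <= K by rewrite lerDr divr_ge0 // ltW.
have K0 : 0 < K by exact: lt_le_trans K1.
have [C C0 hC] := mle_sup_bound R B K hB (ltW K0).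
(* Each sup norm costs one [C]; [n] above [expR 1] ensures [ln n >= 1], hence [r <= rate R n]. *)
exists (2 * C), (maxn 2 (Num.truncn (expR 1 : R)).+1) => n.
rewrite geq_max => /andP[n2 ne].
have [r0 r1 nr] := powR_N8 R n (ltnW n2).
set r := n%:R `^ _ in r0 r1 nr.
have r01 : 0 < r <= 1 by rewrite r0.
have nr2 : 1 <= n%:R * r ^+ 2.
  by rewrite -[leLHS]nr; apply: ler_wpM2l => //; apply: ler_wiXn2l => //; exact: ltW.
have rate_ge : r <= rate R n.
  rewrite /rate -/r ler_peMr ?(ltW r0) // -[leLHS]sqrtr1 ler_wsqrtr //.
  rewrite -[leLHS](expRK 1) ler_ln ?posrE ?expR_gt0 ?ltr0n ?(ltnW n2) //.
  by apply/ltW; rewrite -truncn_lt_nat.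
have -> : eps = 3 * 2 ^+ 14 / (K - 1).
  by rewrite /K addrK; field; rewrite lt0r_neq0.
apply: (@le_lt_trans _ _ (3 * 2 ^+ 14 / K ^+ 4)).
  apply: (noise_prob R n _ _ _ K r _ K0 r01 nr) => a /= bad [h1 [h2 h3]].
  have h := hC n a _ _ _ _ _ _ r n2 r01 nr2 (hstar n) (hmle n a) h1 h2 h3.
  have Cr : 0 <= C * r by rewrite mulr_ge0 // ltW.
  have s1 : supnorm (fun i => ahat n a i - astar n i) <= C * r.
    by apply: bigmax_le => // i _; have [] := h i.
  have s2 : supnorm (fun i => bhat n a i - bstar n i) <= C * r.
    by apply: bigmax_le => // i _; have [] := h i.
  have := ler_wpM2l C0 rate_ge; lra.
have Kp : 0 < K - 1 by rewrite addrK divr_gt0.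
rewrite ltr_pM2l // ltf_pV2 ?posrE ?exprn_gt0 //.
apply: (@lt_le_trans _ _ K); first by rewrite gtrBl.
by rewrite -[leLHS]expr1 ler_weXn2l.
Qed.
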